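(* Let $X$ be a hyperbolike graph with base vertex $x$, and for each integer $n\ge 0$ let $X_n$ be the ball of radius $n$ about $x$ in $X$. For any finite connected graph $Y$, let $b_Y(t)=\sum_{n\ge 0}(Y|X_n)t^n$ be the generating function whose coefficient of $t^n$ is the number of distinct embeddings of $Y$ as a complete subgraph of $X_n$. Then the set $\Omega(b_Y)$ of opposite series of $b_Y$ is finite.
   Context: A connected graph $X$ of finite valence is called $\delta$-hyperbolike (for some $\delta\ge 0$) if (1) $X$, with its path metric in which every edge has length $1$, is $\delta$-hyperbolic (each side of every geodesic triangle lies in the $\delta$-neighborhood of the union of the other two sides), and (2) the automorphism group $\mathrm{Aut}(X)$ acts transitively on the vertices of $X$. It is hyperbolike if it is $\delta$-hyperbolike for some $\delta\ge 0$. $X_n$ is the complete (i.e. full, induced) subgraph of $X$ spanned by the vertices at distance $\le n$ from the base vertex $x$ (an arbitrary vertex). For finite graphs $Y,Z$, $(Y|Z)$ is the number of distinct embeddings of $Y$ as a complete subgraph of $Z$. Opposite series: let $P(t)=\sum_{n=0}^\infty a_n t^n$ be a power series in $t$ with real coefficients $a_n$, and assume there exist $u,v$ such that $u\le a_{n-1}/a_n\le v$ for all $n$. For each $n\ge 0$ define the polynomial in $s$ $$X_n(P)=\sum_{k=0}^{n}\frac{a_{n-k}}{a_n}s^k .$$ $\Omega(P)$ is the set of accumulation points of the sequence $\{X_n(P)\}_n$ in the set of formal power series in $s$, with respect to the product topology on the coefficients (coefficientwise convergence). An element of $\Omega(P)$ is called an opposite series. (The polynomials $X_n(P)$ are not to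 be confused with the balls $X_n$.) *)

(* Defs.v *)
From mathcomp Require Import all_boot all_order all_algebra.
From mathcomp Require Import finmap.
From mathcomp Require Import all_classical all_reals all_analysis.
Set Implicit Arguments.
Unset Strict Implicit.
Unset Printing Implicit Defensive.
Import Order.TTheory GRing.Theory Num.Theory.
Import numFieldNormedType.Exports.
Local Open Scope classical_set_scope.
Local Open Scope ring_scope.

(** * Graphs: an adjacency relation on a vertex type *)

Definition simple_graph (V : Type) (e : rel V) : Prop :=
  symmetric e /\ irreflexive e.

Definition connected_graph (V : eqType) (e : rel V) : Prop :=
  forall u v : V, exists2 w : seq V, path e u w & last u w = v.

Definition finite_valence (V : Type) (e : rel V) : Prop :=
  forall u : V, finite_set [set v | e u v].

Definition graph_automorphism (V : Type) (e : rel V) (f : V -> V) : Prop :=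
  bijective f /\ {mono f : u v / e u v}.

Definition vertex_transitive (V : Type) (e : rel V) : Prop :=
  forall u v : V, exists2 f : V -> V, graph_automorphism e f & f u = v.

(** * The path metric of a graph with unit edges

  A point of the metric graph is given by its barycentric coordinates
  [V -> R].  This represents the points uniquely, since the graphs are simple;
  it takes the interiors of the edges into account, so that the geodesic
  triangles below may have non-vertex corners. *)

Definition edge_point (R : realType) (V : eqType) (u v : V) (t : R) : V -> R :=
  fun w => (1 - t) * (w == u)%:R + t * (w == v)%:R.

Definition vertex_point (R : realType) (V : eqType) (u : V) : V -> R :=
  fun w => (w == u)%:R.

Definition realization (R : realType) (V : eqType) (e : rel V) : set (V -> R) :=
  [set p | (exists u, p = vertex_point R u) \/
           (exists u v t, [/\ e u v, 0 <= t <= 1 & p = edge_point u v t])].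

(* [pl_path e p q l]: there is a piecewise linear path of length [l] from [p]
   to [q], each of whose pieces lies in a single edge *)
Inductive pl_path (R : realType) (V : eqType) (e : rel V) :
    (V -> R) -> (V -> R) -> R -> Prop :=
| pl_nil p : pl_path e p p 0
| pl_cons u v a b q l :
    e u v -> 0 <= a <= 1 -> 0 <= b <= 1 ->
    pl_path e (edge_point u v b) q l ->
    pl_path e (edge_point u v a) q (`|a - b| + l).

Definition path_metric (R : realType) (V : eqType) (e : rel V)
    (p q : V -> R) : R :=
  inf [set l | pl_path e p q l].

Definition geodesic_segment (R : realType) (V : eqType) (e : rel V)
    (p q : V -> R) (A : set (V -> R)) : Prop :=
  exists (l : R) (g : R -> V -> R),
    [/\ 0 <= l,
        forall s, 0 <= s <= l -> realization e (g s),
        forall s t, 0 <= s <= l -> 0 <= t <= l ->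
          path_metric e (g s) (g t) = `|s - t|,
        g 0 = p /\ g l = q &
        A = g @` [set s | 0 <= s <= l]].

Definition neighborhood (R : realType) (V : eqType) (e : rel V) (delta : R)
    (A : set (V -> R)) : set (V -> R) :=
  [set p | exists2 q, A q & path_metric e p q <= delta].

Definition delta_hyperbolic (R : realType) (V : eqType) (e : rel V)
    (delta : R) : Prop :=
  forall (p q r : V -> R) (A B C : set (V -> R)),
    geodesic_segment e p q A ->
    geodesic_segment e q r B ->
    geodesic_segment e r p C ->
    [/\ A `<=` neighborhood e delta (B `|` C),
        B `<=` neighborhood e delta (C `|` A) &
        C `<=` neighborhood e delta (A `|` B)].

Definition delta_hyperbolike (R : realType) (V : eqType) (e : rel V)
    (delta : R) : Prop :=
  [/\ connected_graph e, finite_valence e,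
      delta_hyperbolic e delta & vertex_transitive e].

Definition hyperbolike (R : realType) (V : eqType) (e : rel V) : Prop :=
  exists2 delta : R, 0 <= delta & delta_hyperbolike e delta.

(** * Counting embeddings into balls *)

Definition graph_ball (V : eqType) (e : rel V) (x : V) (n : nat) : set V :=
  [set v | exists w : seq V, [/\ path e x w, last x w = v & (size w <= n)%N]].

(* embeddings of [Y] as a full subgraph of the full subgraph of [V] spanned
   by [A] *)
Definition embeddings (Y : finType) (eY : rel Y) (V : choiceType) (e : rel V)
    (A : set V) : set {ffun Y -> V} :=
  [set f : {ffun Y -> V} | [/\ injective f, {mono f : i j / eY i j >-> e i j} &
      forall i, A (f i)]].

(* [fset_set] is junk on infinite sets, but here [A] is always a ball of a
   graph of finite valence, so that the set of embeddings is finite *)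
Definition num_embeddings (Y : finType) (eY : rel Y) (V : choiceType)
    (e : rel V) (A : set V) : nat :=
  #|` fset_set (embeddings eY e A)|.

(* A power series is its sequence of coefficients. *)
Definition ball_series (R : realType) (Y : finType) (eY : rel Y)
    (V : choiceType) (e : rel V) (x : V) : nat -> R :=
  fun n => (num_embeddings eY e (graph_ball e x n))%:R.

(** * Opposite series

  Division is total, with [a / 0 = 0].  The finitely many vanishing initial
  coefficients that a ball series may have do not affect the accumulation
  points; the bounds required on [a_(n-1) / a_n] are 0 and 1 for such a series,
  which is nonnegative and nondecreasing.  The opposite polynomials of the zero
  series are all 0. *)

Definition opposite_poly (R : realType) (a : nat -> R) (n : nat) : {poly R} :=
  \poly_(k < n.+1) (a (n - k)%N / a n).

Definition poly_series (R : realType) (p : {poly R}) : {ptws nat -> R} :=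
  fun k => p`_k.

(* [{ptws nat -> R}] carries the product topology; accumulation points are
   those of the sequence, i.e. a value taken infinitely often is one *)
Definition opposite_series (R : realType) (a : nat -> R) :
    set {ptws nat -> R} :=
  cluster ((fun n => poly_series (opposite_poly a n)) @ \oo).

(* Main.v *)
Require Import Defs.
From mathcomp Require Import all_boot all_order all_algebra.
From mathcomp Require Import all_classical all_reals all_analysis.
From mathcomp Require Import finmap.
From mathcomp Require Import ring lra zify.
Set Implicit Arguments.
Unset Strict Implicit.
Unset Printing Implicit Defensive.
Import Order.TTheory GRing.Theory Num.Theory.
Import numFieldNormedType.Exports.
Local Open Scope classical_set_scope.
Local Open Scope ring_scope.

(** Thin triangles make the graph have finitely many cone types up to
    automorphism, where a type records the distances to [x] not only on the
    cone of a vertex [v] but on a neighborhood of it: it is determined by the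
    distances to [x] in a ball about [v] of a radius independent of [v].  The
    type of [v] determines the numbers of its successors of each type, the
    number of its predecessors, and how high the embeddings of [Y] rooted at
    [v] reach.  Hence the numbers of vertices of each type on the spheres
    satisfy a linear recursion whose matrix is nonnegative (successors are
    weighted by the inverse of the number of predecessors), and [(Y|X_n)] is a
    nonnegative combination of these numbers and of their partial sums.

    For a nonnegative matrix, the set of positive entries of some power, say
    the [p]-th, is a transitive relation, and then the entries of the iterates
    of that power are either eventually zero or equivalent to [c * n ^ d * L ^
    n] with [c > 0].  This is proved by eliminating the states one by one: the
    class of such sequences is closed under sums and convolutions, and, by the
    renewal theorem, under the operation [1 / (1 - g)] for [g 0 = 0 < g 1].
    Therefore the ratios [(Y|X_(n-k)) / (Y|X_n)] converge along every residue
    class modulo [p], and there are at most [p] opposite series. *)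

(** * Limits of real sequences *)

Lemma cvgn_distP (R : realType) (u : nat -> R) (l : R) :
  (u n @[n --> \oo] --> l) <->
  (forall eps, 0 < eps -> exists N, forall n, (N <= n)%N -> `|u n - l| <= eps).
Proof.
split=> [/cvgrPdist_le ul eps e0|H].
  have [N _ HN] := ul _ e0; exists N => n Nn.
  by rewrite distrC; exact: HN.
apply/cvgrPdist_le => eps e0; have [N HN] := H _ e0.
by exists N => // n /= Nn; rewrite distrC; exact: HN.
Qed.

Lemma cvgn_near_eq (R : realType) (u v : nat -> R) (l : R) (N : nat) :
  (forall n, (N <= n)%N -> u n = v n) ->
  u n @[n --> \oo] --> l -> v n @[n --> \oo] --> l.
Proof.
move=> uv /cvgn_distP ul; apply/cvgn_distP => eps /ul[M HM].
exists (maxn N M) => n; rewrite geq_max => /andP[Nn Mn].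
by rewrite -uv// HM.
Qed.

Lemma cvgn_le_cst (R : realType) (u : nat -> R) (l B : R) (N : nat) :
  (forall n, (N <= n)%N -> u n <= B) -> u n @[n --> \oo] --> l -> l <= B.
Proof.
move=> uB /cvgn_distP ul; apply/ler_addgt0Pr => eps /ul[M HM].
have := HM _ (leq_maxr N M); have := uB _ (leq_maxl N M).
rewrite ler_norml; lra.
Qed.

Lemma cvgn_squeeze0 (R : realType) (u v : nat -> R) (N : nat) :
  (forall n, (N <= n)%N -> `|u n| <= v n) ->
  v n @[n --> \oo] --> 0 -> u n @[n --> \oo] --> 0.
Proof.
move=> uv /cvgn_distP v0; apply/cvgn_distP => eps /v0[M HM].
exists (maxn N M) => n; rewrite geq_max => /andP[Nn Mn].
rewrite subr0 (le_trans (uv _ Nn))//.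
by have := HM n Mn; rewrite subr0; apply: le_trans; exact: ler_norm.
Qed.

Lemma cvgnD (R : realType) (u v : nat -> R) (a b : R) :
  u n @[n --> \oo] --> a -> v n @[n --> \oo] --> b ->
  u n + v n @[n --> \oo] --> a + b.
Proof. by move=> ua vb; exact: cvgD. Qed.

Lemma cvgnB (R : realType) (u v : nat -> R) (a b : R) :
  u n @[n --> \oo] --> a -> v n @[n --> \oo] --> b ->
  u n - v n @[n --> \oo] --> a - b.
Proof. by move=> ua vb; exact: cvgB. Qed.

Lemma cvgnM (R : realType) (u v : nat -> R) (a b : R) :
  u n @[n --> \oo] --> a -> v n @[n --> \oo] --> b ->
  u n * v n @[n --> \oo] --> a * b.
Proof. by move=> ua vb; exact: cvgM. Qed.

Lemma cvgnZ (R : realType) (c : R) (u : nat -> R) (a : R) :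
  u n @[n --> \oo] --> a -> c * u n @[n --> \oo] --> c * a.
Proof. by move=> ua; apply: cvgnM => //; exact: cvg_cst. Qed.

Arguments cvgnZ {R} c {u a}.

Lemma cvgn_div (R : realType) (u v : nat -> R) (a b : R) : b != 0 ->
  u n @[n --> \oo] --> a -> v n @[n --> \oo] --> b ->
  u n / v n @[n --> \oo] --> a / b.
Proof. by move=> b0 ua vb; apply: cvgnM => //; exact: cvgV. Qed.

(** * Convolution *)

Definition conv (R : realType) (f g : nat -> R) (n : nat) : R :=
  \sum_(k < n.+1) f k * g (n - k)%N.

(** The value at [n] only involves coefficients up to [n], so sequences may be truncated to
    polynomials; commutativity and associativity of [conv] then come from the polynomial ring. *)
Lemma conv_coef (R : realType) (f g : nat -> R) (p q : {poly R}) n :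
  (forall k, (k <= n)%N -> p`_k = f k) ->
    (forall k, (k <= n)%N -> q`_k = g k) ->
  conv f g n = (p * q)`_n.
Proof.
move=> pf qg; rewrite coefM; apply: eq_bigr => k _.
by rewrite pf ?qg ?leq_subr// -ltnS.
Qed.

Lemma coef_trunc (R : realType) (f : nat -> R) N k :
  (k <= N)%N -> (\poly_(i < N.+1) f i)`_k = f k.
Proof. by move=> kN; rewrite coef_poly ltnS kN. Qed.

Lemma convC (R : realType) (f g : nat -> R) : conv f g = conv g f.
Proof.
apply/funext => n.
by rewrite !(conv_coef (@coef_trunc _ _ n) (@coef_trunc _ _ n)) mulrC.
Qed.

Lemma convA (R : realType) (f g h : nat -> R) :
  conv f (conv g h) = conv (conv f g) h.
Proof.
apply/funext => n; set t := fun u : nat -> R => \poly_(i < n.+1) u i.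
have tE u k : (k <= n)%N -> (t u)`_k = u k by exact: coef_trunc.
have cE u v k : (k <= n)%N -> (t u * t v)`_k = conv u v k.
  by move=> kn; rewrite (@conv_coef _ _ _ (t u) (t v))// => j jk;
    exact: tE (leq_trans jk kn).
rewrite (@conv_coef _ _ _ (t f) (t g * t h))//; [|exact: tE|exact: cE].
rewrite (@conv_coef _ _ _ (t f * t g) (t h))//; [|exact: cE|exact: tE].
by rewrite mulrA.
Qed.

Lemma convDl (R : realType) (f g h : nat -> R) :
  conv (f \+ g) h = conv f h \+ conv g h.
Proof.
apply/funext => n; rewrite /conv /= -big_split/=.
by apply: eq_bigr => k _; rewrite mulrDl.
Qed.

Lemma convDr (R : realType) (f g h : nat -> R) :
  conv h (f \+ g) = conv h f \+ conv h g.
Proof. by rewrite !(convC h) convDl. Qed.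

Lemma convZl (R : realType) (a : R) (f h : nat -> R) :
  conv (a \*o f) h = a \*o conv f h.
Proof.
apply/funext => n; rewrite /conv /= mulr_sumr.
by apply: eq_bigr => k _; rewrite mulrA.
Qed.

Lemma conv_geo (R : realType) (L : R) (f g : nat -> R) n :
  conv (fun k => f k * L ^+ k) (fun k => g k * L ^+ k) n =
  conv f g n * L ^+ n.
Proof.
rewrite /conv mulr_suml; apply: eq_bigr => k _.
by rewrite mulrACA -exprD subnKC// -ltnS.
Qed.

Lemma conv_ge0 (R : realType) (f g : nat -> R) n :
  (forall n, 0 <= f n) -> (forall n, 0 <= g n) -> 0 <= conv f g n.
Proof. by move=> f0 g0; apply: sumr_ge0 => k _; exact: mulr_ge0. Qed.

Definition delta0 (R : realType) (n : nat) : R := (n == 0)%:R.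

Lemma conv_delta0l (R : realType) (f : nat -> R) : conv (@delta0 R) f = f.
Proof.
apply/funext => n; rewrite /conv big_ord_recl subn0 mul1r big1 ?addr0// => k _.
by rewrite /delta0 lift0 mul0r.
Qed.

Lemma convS0 (R : realType) (g u : nat -> R) n : g 0%N = 0 ->
  conv g u n.+1 = \sum_(k < n.+1) g k.+1 * u (n - k)%N.
Proof.
move=> g0; rewrite /conv big_ord_recl g0 mul0r add0r.
by apply: eq_bigr => k _; rewrite lift0 subSS.
Qed.

(** * Growth scales *)

(* Equivalent to [n ^ d / d!], but with exact convolutions. *)
Definition beta (R : realType) (d n : nat) : R := 'C(n + d, d)%:R.

Lemma beta_gt0 (R : realType) d n : 0 < beta R d n.
Proof. by rewrite ltr0n bin_gt0 leq_addl. Qed.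

Lemma beta_ge0 (R : realType) d n : 0 <= beta R d n.
Proof. exact: ler0n. Qed.

Lemma beta_ge1 (R : realType) d n : 1 <= beta R d n.
Proof. by rewrite ler1n bin_gt0 leq_addl. Qed.

Lemma beta0 (R : realType) n : beta R 0 n = 1.
Proof. by rewrite /beta bin0. Qed.

Lemma betaS (R : realType) d n :
  beta R d.+1 n = (n + d.+1)%:R / d.+1%:R * beta R d n.
Proof.
have d0 : d.+1%:R != 0 :> R by rewrite pnatr_eq0.
apply: (mulfI d0); rewrite mulrA mulrCA divff// mulr1.
by rewrite /beta -!natrM addnS -mul_bin_diag.
Qed.

Lemma le_beta (R : realType) d : {homo beta R d : m n / (m <= n)%N >-> m <= n}.
Proof.
move=> m n mn; elim: d => [|d IH]; first by rewrite !beta0.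
rewrite !betaS; apply: ler_pM; rewrite ?beta_ge0//.
by rewrite ler_pM2r ?invr_gt0 ?ltr0n// ler_nat leq_add2r.
Qed.

(** Hockey-stick identity. As a generating function, [beta d] is the expansion of
    [1 / (1 - t) ^ (d + 1)], whence the degree [(d + d').+1] of a convolution. *)
Lemma conv1_beta (R : realType) d : conv (beta R 0) (beta R d) = beta R d.+1.
Proof.
apply/funext; elim=> [|n IH].
  by rewrite /conv big_ord_recl big_ord0 beta0 /beta !binn mulr1 addr0.
rewrite /conv big_ord_recl beta0 mul1r subn0.
transitivity (beta R d n.+1 + conv (beta R 0) (beta R d) n).
  by congr (_ + _); apply: eq_bigr => k _; rewrite lift0 subSS !beta0.
by rewrite IH /beta -natrD [(n.+1 + d.+1)%N]addnS binS addnC addSnnS.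
Qed.

Lemma conv_beta (R : realType) d d' :
  conv (beta R d) (beta R d') = beta R (d + d').+1.
Proof.
elim: d => [|d IH]; first exact: conv1_beta.
by rewrite -conv1_beta -convA IH conv1_beta.
Qed.

(** Up to the factor [(1 - r) ^ d], the left-hand side is one term of the binomial expansion of
    [((1 - r) + r) ^ (n + d) = 1]. *)
Lemma beta_geo_le (R : realType) d n (r : R) : 0 <= r < 1 ->
  beta R d n * r ^+ n <= ((1 - r) ^+ d)^-1.
Proof.
move=> /andP[r0 r1]; have r1' : 0 < (1 - r) ^+ d by rewrite exprn_gt0 ?subr_gt0.
rewrite -[leRHS]mul1r ler_pdivlMr//.
suff : beta R d n * r ^+ n * (1 - r) ^+ d <= ((1 - r) + r) ^+ (n + d).
  by rewrite subrK expr1n.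
rewrite [leRHS]exprDn.
have dn : (n < (n + d).+1)%N by rewrite ltnS leq_addr.
rewrite (bigD1 (Ordinal dn))//= addKn.
rewrite -[X in X <= _]addr0 lerD//.
  rewrite /beta -(bin_sub (leq_addr d n)) addKn -[leRHS]mulr_natl.
  by rewrite mulrA mulrAC.
by apply: sumr_ge0 => i _; rewrite mulrn_wge0// mulr_ge0// exprn_ge0// subr_ge0
  ltW.
Qed.

Lemma beta_geo_decay (R : realType) d (r : R) : 0 < r < 1 ->
  exists C r' : R, [/\ 0 <= C, 0 < r' < 1 & forall n,
    beta R d n * r ^+ n <= C * r' ^+ n].
Proof.
(* With [s] strictly between [r] and 1, the factor [(r / s) ^ n] absorbs the polynomial growth and
   [s ^ n] is left over. *)
move=> /andP[r0 r1]; pose s := (1 + r) / 2.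
have s0 : 0 < s by rewrite /s; lra.
have rs : r < s by rewrite /s; lra.
have s1 : s < 1 by rewrite /s; lra.
have q1 : 0 < r / s < 1 by rewrite divr_gt0//= ltr_pdivrMr// mul1r.
have r1s : 0 < 1 - r / s by case/andP: q1; rewrite subr_gt0.
exists (((1 - r / s) ^+ d)^-1), s; split.
- by rewrite invr_ge0 exprn_ge0// ltW.
- by rewrite s0.
- move=> n; have -> : r ^+ n = (r / s) ^+ n * s ^+ n.
    by rewrite -exprMn divfK// gt_eqF.
  by rewrite mulrA ler_pM2r ?exprn_gt0// beta_geo_le// (andP q1).2 ltW
    ?(andP q1).1.
Qed.

Lemma geo_sum_le (R : realType) (r : R) n : 0 <= r < 1 ->
  \sum_(k < n) r ^+ k <= (1 - r)^-1.
Proof.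
move=> /andP[r0 r1]; have r1' : 0 < 1 - r by rewrite subr_gt0.
rewrite -[leRHS]mul1r ler_pdivlMr// mulrC -opprB mulNr -subrX1 opprB.
by rewrite lerBlDr lerDl exprn_ge0.
Qed.

(** * Series with nonnegative terms *)

Lemma nonneg_series_cvg (R : realType) (q : nat -> R) (B : R) :
  (forall k, 0 <= q k) -> (forall n, \sum_(k < n) q k <= B) ->
  exists Q : R, (\sum_(k < n) q k @[n --> \oo] --> Q) /\
            forall n, \sum_(k < n) q k <= Q.
Proof.
move=> q0 qB; set u := fun n => \sum_(k < n) q k.
have uS n : u n <= u n.+1 by rewrite /u big_ord_recr/= lerDl.
have nd : {homo u : m n / (m <= n)%N >-> m <= n} by apply/nondecreasing_seqP.
have cu : cvgn u.
  by apply: nondecreasing_is_cvgn => //; exists B => _ [n _ <-]; exact: qB.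
by exists (limn u); split=> // n; exact: nondecreasing_cvgn_le.
Qed.

Lemma cvgn_sum0 (R : realType) (w : nat -> nat -> R) K :
  (forall k, w n k @[n --> \oo] --> 0) ->
  \sum_(k < K) w n k @[n --> \oo] --> 0.
Proof.
move=> w0; elim: K => [|K IH].
  by under eq_fun do rewrite big_ord0; exact: cvg_cst.
under eq_fun do rewrite big_ord_recr/=.
by have := cvgnD IH (w0 K); rewrite addr0.
Qed.

(** Dominated convergence: the finitely many terms with [k < K] converge one by one, and the others
    are controlled by the tail of the series of [q]. *)
Lemma tannery (R : realType) (q : nat -> R) (Q M L : R) (w : nat -> nat -> R) :
  (forall k, 0 <= q k) -> \sum_(k < n) q k @[n --> \oo] --> Q ->
  (forall n k, (k <= n)%N -> `|w n k| <= M) ->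
  (forall k, w n k @[n --> \oo] --> L) ->
  \sum_(k < n.+1) q k * w n k @[n --> \oo] --> L * Q.
Proof.
move=> q0 qQ wM wL.
have qS n : \sum_(k < n.+1) q k <= Q.
  have nd : {homo (fun n => \sum_(k < n) q k) : m n / (m <= n)%N >-> m <= n}.
    by apply/nondecreasing_seqP => m; rewrite big_ord_recr/= lerDl.
  have cq : cvgn (fun n => \sum_(k < n) q k) by apply/cvg_ex; exists Q.
  by rewrite -(cvg_lim _ qQ)//; exact: (nondecreasing_cvgn_le nd cq n.+1).
suff E : \sum_(k < n.+1) q k * (w n k - L) @[n --> \oo] --> 0.
  have qQ1 : \sum_(k < n.+1) q k @[n --> \oo] --> Q.
    by move: qQ; rewrite -(cvg_shiftS (fun n => \sum_(k < n) q k)).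
  rewrite -[L * Q]add0r.
  apply: (@cvgn_near_eq _ _ _ _ 0%N _ (cvgnD E (cvgnZ L qQ1))) => n _ /=.
  rewrite mulr_sumr -big_split/=.
  by apply: eq_bigr => k _; ring.
apply/cvgn_distP => eps e0.
have M0 : 0 <= M by exact: le_trans (wM 0%N 0%N _).
have ML : 0 < M + `|L| + 1 by rewrite ltr_wpDl// addr_ge0.
have e1 : 0 < eps / 2 / (M + `|L| + 1) by rewrite !divr_gt0.
have /cvgn_distP/(_ _ e1)[K HK] := qQ.
have e2 : 0 < eps / 2 by lra.
have /cvgn_distP/(_ _ e2)[N HN] :
    \sum_(k < K) q k * `|w n k - L| @[n --> \oo] --> 0.
  apply: (@cvgn_sum0 _ (fun n k => q k * `|w n k - L|)) => k.
  have := cvgnZ (q k) (cvg_norm (cvgnB (wL k) (cvg_cst L))).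
  by rewrite subrr normr0 mulr0; exact.
exists (maxn N K) => n; rewrite geq_max => /andP[Nn Kn]; rewrite subr0.
apply: le_trans (ler_norm_sum _ _ _) _.
under eq_bigr do rewrite normrM ger0_norm ?q0//.
have Kn1 : (K <= n.+1)%N by exact: leqW.
rewrite -(big_mkord xpredT (fun k => q k * `|w n k - L|))
  (@big_cat_nat _ _ _ K)//=.
rewrite big_mkord [eps]splitr lerD//.
  by have := HN n Nn; rewrite subr0; apply: le_trans; exact: ler_norm.
have : \sum_(K <= k < n.+1) q k * `|w n k - L| <=
       \sum_(K <= k < n.+1) q k * (M + `|L| + 1).
  rewrite big_nat [leRHS]big_nat; apply: ler_sum => k /andP[_ kn].
  apply: ler_wpM2l => //; apply: le_trans (ler_normB _ _) _.
  by have := wM n k kn; lra.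
move=> /le_trans; apply; rewrite -mulr_suml -ler_pdivlMr//.
have := HK K (leqnn K); have := qS n.
rewrite -(big_mkord xpredT q) (@big_cat_nat _ _ _ K)//= big_mkord ler_norml.
lra.
Qed.

Lemma cvgn_geo0 (R : realType) (C r : R) : 0 < r < 1 ->
  C * r ^+ n @[n --> \oo] --> 0.
Proof.
move=> /andP[r0 r1]; rewrite -(mulr0 C); apply: cvgnZ.
by apply: cvg_expr; rewrite gtr0_norm.
Qed.

Lemma cvgn_bounded (R : realType) (u : nat -> R) (l : R) :
  u n @[n --> \oo] --> l -> exists2 M : R, 0 <= M & forall n, `|u n| <= M.
Proof.
move=> /cvgn_distP/(_ 1 ltr01)[N HN].
exists (`|l| + 1 + \sum_(k < N) `|u k|).
  by rewrite addr_ge0 ?sumr_ge0 ?addr_ge0.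
move=> n; have [Nn|nN] := leqP N n.
  have -> : u n = l + (u n - l) by ring.
  apply: (le_trans (ler_normD _ _)); rewrite -[leLHS]addr0.
  by rewrite !lerD ?HN ?sumr_ge0.
rewrite (bigD1 (Ordinal nN))//= addrCA lerDl.
by rewrite addr_ge0 ?sumr_ge0 ?addr_ge0.
Qed.

Lemma inv_succ_cvg0 (R : realType) (a : R) d :
  a / (n + d.+1)%:R @[n --> \oo] --> 0.
Proof.
rewrite -(mulr0 a); apply: cvgnZ; apply/cvgn_distP => eps e0.
have /cvgn_distP/(_ _ e0)[N HN] := @cvg_harmonic R.
exists N => n Nn; have := HN (n + d)%N (leq_trans Nn (leq_addr _ _)).
by rewrite /harmonic /= addnS.
Qed.

(** By [betaS], raising the degree multiplies the ratio by [1 - k / (n + d.+1)], which tends to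
    1. *)
Lemma beta_shift_cvg (R : realType) d k :
  beta R d (n - k) / beta R d n @[n --> \oo] --> (1 : R).
Proof.
elim: d => [|d IH].
  by apply: (@cvgn_near_eq _ (fun=> 1) _ _ 0%N); [|exact: cvg_cst] => n _;
    rewrite !beta0 divr1.
have H : 1 - k%:R / (n + d.+1)%:R @[n --> \oo] --> (1 : R).
  by rewrite -[X in _ --> X]subr0; apply: cvgnB;
    [exact: cvg_cst|exact: inv_succ_cvg0].
have := cvgnM H IH; rewrite mulr1; apply: (@cvgn_near_eq _ _ _ _ k) => n kn.
rewrite !betaS.
have n0 : (n + d.+1)%:R != 0 :> R by rewrite pnatr_eq0 addnS.
have d0 : d.+1%:R != 0 :> R by rewrite pnatr_eq0.
have b0 := lt0r_neq0 (beta_gt0 R d n).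
have -> : (n - k + d.+1)%:R = (n + d.+1)%:R - k%:R :> R.
  by rewrite -natrB 1?addnBAC// (leq_trans kn)// leq_addr.
move: ((n + d.+1)%:R : R) (d.+1%:R : R) (beta R d n) n0 d0 b0.
by move=> a b c a0 b0 c0; field; rewrite a0 b0 c0.
Qed.

Lemma beta_ratio_cvg0 (R : realType) d d' : (d < d')%N ->
  beta R d n / beta R d' n @[n --> \oo] --> (0 : R).
Proof.
elim: d' => // d' IH; rewrite ltnS leq_eqVlt => /orP[/eqP->|/IH H].
  apply: (cvgn_near_eq (N := 0%N)) (inv_succ_cvg0 d'.+1%:R d') => n _.
  rewrite betaS; have b0 := lt0r_neq0 (beta_gt0 R d' n).
  have n0 : (n + d'.+1)%:R != 0 :> R by rewrite pnatr_eq0 addnS.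
  have d0 : d'.+1%:R != 0 :> R by rewrite pnatr_eq0.
  move: ((n + d'.+1)%:R : R) (d'.+1%:R : R) (beta R d' n) n0 d0 b0.
  by move=> a b c a0 b0 c0; field; rewrite a0 b0 c0.
apply: (cvgn_squeeze0 (N := 0%N)) H => n _.
rewrite ger0_norm ?divr_ge0 ?beta_ge0//.
rewrite ler_pM2l ?beta_gt0// lef_pV2 ?posrE ?beta_gt0//.
rewrite betaS ler_peMl ?beta_ge0// ler_pdivlMr ?ltr0n// mul1r ler_nat.
by rewrite leq_addl.
Qed.

(** * Sequences with a leading term, and their sums and convolutions *)

Definition scale (R : realType) (d : nat) (L : R) (n : nat) : R :=
  beta R d n * L ^+ n.

Lemma scale_gt0 (R : realType) d (L : R) n : 0 < L -> 0 < scale d L n.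
Proof. by move=> L0; rewrite mulr_gt0 ?beta_gt0 ?exprn_gt0. Qed.

Lemma scale_ge0 (R : realType) d (L : R) n : 0 < L -> 0 <= scale d L n.
Proof. by move=> L0; exact: ltW (scale_gt0 _ _ L0). Qed.

Lemma scale_decay (R : realType) d (L L' : R) : 0 < L < L' ->
  exists C r : R, [/\ 0 <= C, 0 < r < 1 & forall n,
    scale d L n / L' ^+ n <= C * r ^+ n].
Proof.
move=> /andP[L0 LL']; have L'0 := lt_trans L0 LL'.
have q : 0 < L / L' < 1 by rewrite divr_gt0//= ltr_pdivrMr// mul1r.
have [C [r [C0 r1 H]]] := beta_geo_decay d q; exists C, r; split=> // n.
by rewrite /scale -mulrA -expr_div_n.
Qed.

Definition scale_lt (R : realType) (d : nat) (L : R) (d' : nat) (L' : R) :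
  bool :=
  (L < L') || ((L == L') && (d < d')%N).

Lemma scale_ratio_cvg0 (R : realType) d (L : R) d' L' :
  0 < L -> scale_lt d L d' L' ->
  scale d L n / scale d' L' n @[n --> \oo] --> 0.
Proof.
move=> L0 /orP[LL'|/andP[/eqP<- dd']].
  have L'0 := lt_trans L0 LL'.
  have [|C [r [C0 r1 H]]] := @scale_decay _ d L L'; first by rewrite L0.
  apply: (cvgn_squeeze0 (N := 0%N)) (cvgn_geo0 C r1) => n _.
  rewrite ger0_norm ?divr_ge0 ?scale_ge0//.
  apply: le_trans (H n); rewrite ler_pM2l ?scale_gt0//.
  rewrite lef_pV2 ?posrE ?scale_gt0 ?exprn_gt0//.
  by rewrite /scale ler_peMl ?beta_ge1// exprn_ge0// ltW.
apply: (cvgn_near_eq (N := 0%N)) (beta_ratio_cvg0 (R := R) dd') => n _.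
rewrite /scale; have b0 := lt0r_neq0 (beta_gt0 R d' n).
have l0 : L ^+ n != 0 by rewrite expf_neq0// lt0r_neq0.
by field; rewrite b0 l0.
Qed.

Lemma scale_total (R : realType) d (L : R) d' L' :
  [\/ scale_lt d L d' L', d = d' /\ L = L' | scale_lt d' L' d L].
Proof.
rewrite /scale_lt; have [LL|LL|->] := ltgtP L L';
  [by apply: Or31|by apply: Or33|].
by case: (ltngtP d d') => dd; [apply: Or31|apply: Or33|apply: Or32].
Qed.

Definition asym (R : realType) (f : nat -> R) (d : nat) (L c : R) : Prop :=
  f n / scale d L n @[n --> \oo] --> c.

(** The leading constant is positive, so leading terms cannot cancel in sums. Eventually zero
    sequences have no leading term and form a separate case. *)
Definition tame (R : realType) (f : nat -> R) : Prop :=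
  (exists N, forall n, (N <= n)%N -> f n = 0) \/
  (exists (d : nat) (L c : R), [/\ 0 < L, 0 < c & asym f d L c]).

Lemma tame_eq (R : realType) (f g : nat -> R) N :
  (forall n, (N <= n)%N -> f n = g n) -> tame f -> tame g.
Proof.
move=> fg [[M HM]|[d [L [c [L0 c0 H]]]]]; [left|right].
  by exists (maxn M N) => n; rewrite geq_max => /andP[Mn Nn]; rewrite -fg// HM.
by exists d, L, c; split=> //; apply: cvgn_near_eq H => n /fg ->.
Qed.

Lemma asym_bound (R : realType) (f : nat -> R) d (L c : R) : 0 < L ->
  asym f d L c -> exists2 M : R, 0 <= M & forall n, `|f n| <= M * scale d L n.
Proof.
move=> L0 /cvgn_bounded[M M0 H]; exists M => // n.
have s0 : 0 < scale d L n by exact: scale_gt0.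
by have := H n; rewrite normrM normfV (gtr0_norm s0) ler_pdivrMr.
Qed.

Lemma asym_decay (R : realType) (f : nat -> R) d (L c L' : R) : 0 < L < L' ->
  asym f d L c ->
  exists C r : R, [/\ 0 <= C, 0 < r < 1 & forall n,
    `|f n| / L' ^+ n <= C * r ^+ n].
Proof.
move=> LL' fL; have L0 : 0 < L by case/andP: LL'.
have L'0 : 0 < L' by case/andP: LL' => _; exact: lt_trans.
have [M M0 HM] := asym_bound L0 fL; have [C [r [C0 r1 H]]] := scale_decay d LL'.
exists (M * C), r; split=> //; first exact: mulr_ge0.
move=> n; have := ler_wpM2l M0 (H n); rewrite mulrA [leRHS]mulrA;
  apply: le_trans.
by rewrite ler_pM2r ?invr_gt0 ?exprn_gt0.
Qed.

Lemma asym_dom (R : realType) (f : nat -> R) d (L c : R) d' L' : 0 < L ->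
  0 < L' ->
  asym f d L c -> scale_lt d L d' L' -> asym f d' L' 0.
Proof.
move=> L0 L'0 fL /(scale_ratio_cvg0 L0) H.
have := cvgnM fL H; rewrite mulr0; apply: (cvgn_near_eq (N := 0%N)) => n _.
by rewrite mulrA divfK// lt0r_neq0// scale_gt0.
Qed.

Lemma tameZ (R : realType) (a : R) (f : nat -> R) : 0 <= a -> tame f ->
  tame (fun n => a * f n).
Proof.
rewrite le_eqVlt => /predU1P[<- _|a0]; first by left; exists 0%N => n _;
  rewrite mul0r.
case=> [[N HN]|[d [L [c [L0 c0 H]]]]].
  by left; exists N => n /HN ->; rewrite mulr0.
right; exists d, L, (a * c); split=> //; first exact: mulr_gt0.
by apply: (cvgn_near_eq (N := 0%N)) (cvgnZ a H) => n _; rewrite mulrA.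
Qed.

(** The larger scale wins; on equal scales the constants add up to a positive one. *)
Lemma tameD (R : realType) (f g : nat -> R) : tame f -> tame g ->
  tame (fun n => f n + g n).
Proof.
case=> [[N HN]|[d [L [c [L0 c0 H]]]]].
  by apply: (tame_eq (N := N)) => n /HN ->; rewrite add0r.
move=> tg; case: (tg) => [[N HN]|[d' [L' [c' [L'0 c'0 H']]]]].
  suff : tame f by apply: (tame_eq (N := N)) => n /HN ->; rewrite addr0.
  by right; exists d, L, c.
have add e (M a b : R) : asym f e M a -> asym g e M b ->
    asym (fun n => f n + g n) e M (a + b).
  move=> fa gb; apply: (cvgn_near_eq (N := 0%N)) (cvgnD fa gb) => n _.
  by rewrite mulrDl.
right; have [lt|[ed eL]|lt] := scale_total d L d' L'.
- exists d', L', c'; split=> //; rewrite -[c']add0r.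
  by apply: add => //; exact: asym_dom L0 L'0 H lt.
- exists d, L, (c + c'); split=> //; first exact: addr_gt0.
  by apply: add => //; rewrite ed eL.
- exists d, L, c; split=> //; rewrite -[c]addr0.
  by apply: add => //; exact: asym_dom L'0 L0 H' lt.
Qed.

Lemma tame0 (R : realType) : tame (fun _ : nat => 0 : R).
Proof. by left; exists 0%N. Qed.

Lemma tame_sum (R : realType) (I : Type) (s : seq I) (f : I -> nat -> R) :
  (forall i, tame (f i)) -> tame (fun n => \sum_(i <- s) f i n).
Proof.
move=> tf; elim: s => [|i s IH].
  by apply: (tame_eq (N := 0%N)) (tame0 R) => n _; rewrite big_nil.
by apply: (tame_eq (N := 0%N)) (tameD (tf i) IH) => n _; rewrite big_cons.
Qed.

(** The scales of [f] and [g] are comparable, and that of [f] cannot be the larger one because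
    [f <= g]. *)
Lemma tame_ratio_cvg (R : realType) (f g : nat -> R) : tame f -> tame g ->
  (forall n, 0 <= f n <= g n) -> exists l : R, f n / g n @[n --> \oo] --> l.
Proof.
move=> tf tg fg.
have [[N HN]|[d [L [c [L0 c0 H]]]]] := tf.
  exists 0; apply: (@cvgn_near_eq _ (fun=> 0) _ _ N) => [n /HN ->|];
    last exact: cvg_cst.
  by rewrite mul0r.
have [[N HN]|[d' [L' [c' [L'0 c'0 H']]]]] := tg.
  exists 0; apply: (@cvgn_near_eq _ (fun=> 0) _ _ N) => [n /HN ->|];
    last exact: cvg_cst.
  by rewrite invr0 mulr0.
have div e (M a b : R) : 0 < M -> b != 0 -> asym f e M a -> asym g e M b ->
    f n / g n @[n --> \oo] --> a / b.
  move=> M0 b0 fa gb; apply: (cvgn_near_eq (N := 0%N)) (cvgn_div b0 fa gb) => n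
    _.
  by rewrite -mulf_div divff ?mulr1// invr_eq0 lt0r_neq0// scale_gt0.
have [lt|[ed eL]|lt] := scale_total d L d' L'.
- exists (0 / c'); apply: (div d' L') => //; first exact: lt0r_neq0.
  exact: asym_dom L0 L'0 H lt.
- exists (c / c'); apply: (div d' L') => //; first exact: lt0r_neq0.
  by rewrite -ed -eL.
- have H0 := asym_dom L'0 L0 H' lt.
  suff : c <= 0 by rewrite leNgt c0.
  apply: (cvgn_le_cst (N := 0%N) (u :=
    fun n => f n / scale d L n - g n / scale d L n)).
    move=> n _; rewrite -mulrBl mulr_le0_ge0 ?invr_ge0 ?scale_ge0//.
    by rewrite subr_le0; case/andP: (fg n).
  by rewrite -[c]subr0; exact: cvgnB.
Qed.

(* Tannery's theorem with terms [q k * F (n - k) / beta d n]. *)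
Lemma conv_summable_beta (R : realType) (q F : nat -> R) (Q c : R) d :
  (forall k, 0 <= q k) -> \sum_(k < n) q k @[n --> \oo] --> Q ->
  F n / beta R d n @[n --> \oo] --> c ->
  conv q F n / beta R d n @[n --> \oo] --> c * Q.
Proof.
move=> q0 qQ Fc; have [M M0 HM] := cvgn_bounded Fc.
have FM n : `|F n| <= M * beta R d n.
  by have := HM n; rewrite normrM normfV (gtr0_norm (beta_gt0 _ _ _))
    ler_pdivrMr ?beta_gt0.
have := @tannery R q Q M c (fun n k => F (n - k)%N / beta R d n) q0 qQ.
move=> T; have {}T : \sum_(k < n.+1) q k * (F (n - k)%N / beta R d n)
  @[n --> \oo] --> c * Q.
  apply: T => [n k kn|k].
    rewrite normrM normfV (gtr0_norm (beta_gt0 _ _ _)) ler_pdivrMr ?beta_gt0//.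
    by apply: le_trans (FM _) _; rewrite ler_wpM2l// le_beta// leq_subr.
  have Fk : F (n - k)%N / beta R d (n - k)%N @[n --> \oo] --> c.
    apply/cvgn_distP => eps e0; move/cvgn_distP: Fc => /(_ _ e0)[N HN].
    by exists (N + k)%N => n Nn; apply: HN;
      rewrite leq_subRL 1?addnC// (leq_trans _ Nn)// leq_addl.
  have := cvgnM Fk (@beta_shift_cvg R d k); rewrite mulr1.
  by apply: (cvgn_near_eq (N := 0%N)) => n _;
    rewrite mulrA divfK// lt0r_neq0// beta_gt0.
apply: (cvgn_near_eq (N := 0%N)) T => n _; rewrite /conv mulr_suml.
by apply: eq_bigr => k _; rewrite mulrA.
Qed.

(** Beyond some [K], [F] is below a small multiple of [beta d], whose convolution with [beta d'] has
    degree [(d + d').+1]. The finitely many earlier terms contribute only the order of [beta d'],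
    which is lower. *)
Lemma conv_beta_o (R : realType) (F G : nat -> R) d d' (M : R) :
  F n / beta R d n @[n --> \oo] --> 0 ->
    (forall n, `|G n| <= M * beta R d' n) ->
  conv F G n / beta R (d + d').+1 n @[n --> \oo] --> 0.
Proof.
move=> F0 GM; apply/cvgn_distP => eps e0.
have M0 : 0 <= M.
  by have := le_trans (normr_ge0 _) (GM 0%N); rewrite pmulr_lge0// beta_gt0.
have e1 : 0 < eps / 2 / (M + 1) by rewrite !divr_gt0// ltr_wpDl.
have [K HK] := (cvgn_distP _ _).1 F0 _ e1.
pose C := \sum_(k < K) `|F k|.
have C0 : 0 <= C by exact: sumr_ge0.
have lt : (d' < (d + d').+1)%N by rewrite ltnS leq_addl.
have /cvgn_distP/(_ (eps / 2))[|N HN] :=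
  cvgnZ (M * C) (beta_ratio_cvg0 (R := R) lt).
  by rewrite divr_gt0.
exists N => n Nn; rewrite subr0.
have b0 := beta_gt0 R (d + d').+1 n.
rewrite normrM normfV (gtr0_norm b0) ler_pdivrMr//.
have FK k : `|F k| <= eps / 2 / (M + 1) * beta R d k + (k < K)%:R * `|F k|.
  have [kK|Kk] := ltnP k K; first by rewrite mul1r lerDr mulr_ge0 ?beta_ge0//
    ltW.
  have := HK k Kk; rewrite subr0 normrM normfV (gtr0_norm (beta_gt0 _ _ _)).
  by rewrite ler_pdivrMr ?beta_gt0// mul0r addr0.
have step : `|conv F G n| <= eps / 2 / (M + 1) * M * beta R (d + d').+1 n +
    M * C * beta R d' n.
  apply: le_trans (ler_norm_sum _ _ _) _.
  have -> : eps / 2 / (M + 1) * M * beta R (d + d').+1 n =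
    \sum_(k < n.+1) eps / 2 / (M + 1) * beta R d k * (M * beta R d' (n - k)).
    rewrite -conv_beta /conv mulr_sumr; apply: eq_bigr => k _; ring.
  have H : \sum_(k < n.+1) (k < K)%:R * `|F k| * (M * beta R d' (n - k)) <=
      M * C * beta R d' n.
    apply: (@le_trans _ _ (\sum_(k < n.+1) (k < K)%:R * `|F k| *
      (M * beta R d' n))).
      apply: ler_sum => k _; rewrite ler_wpM2l ?mulr_ge0//.
      by rewrite ler_wpM2l// le_beta// leq_subr.
    rewrite -mulr_suml [leRHS]mulrAC [leRHS]mulrC ler_wpM2r ?mulr_ge0
      ?beta_ge0//.
    rewrite -(big_mkord xpredT (fun k => (k < K)%:R * `|F k|)).
    under eq_bigr do rewrite mulr_natl mulrb.
    rewrite -big_mkcond/= /C.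
    rewrite (big_nat_widen _ _ (maxn n.+1 K)) ?leq_maxl//=.
    rewrite -(big_mkord xpredT (fun k => `|F k|))
      (big_nat_widen _ K (maxn n.+1 K)) ?leq_maxr//=.
    rewrite big_mkcond [leRHS]big_mkcond/=; apply: ler_sum => k _.
    by case: ifP => [/andP[->]|]//; case: ifP.
  apply: le_trans (lerD (lexx _) H); rewrite -big_split/=.
  apply: ler_sum => k _; rewrite normrM -mulrDl.
  by apply: ler_pM.
apply: (le_trans step); rewrite [eps in leRHS]splitr mulrDl lerD//.
  rewrite ler_wpM2r ?beta_ge0// -mulrA ger_pMr ?divr_gt0//.
  by rewrite mulrC ler_pdivrMr ?ltr_wpDl// mul1r lerDl.
have H := HN n Nn; rewrite mulr0 subr0 mulrA in H.
by rewrite -ler_pdivrMr//; apply: le_trans H; exact: ler_norm.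
Qed.

(** With products standing for convolutions, [F G] is [(F - c beta d) G + c beta d (G - c' beta d')
    + c c' beta d beta d']; the first two terms are negligible by [conv_beta_o] and the last one is
    exact. *)
Lemma conv_beta_asym (R : realType) (F G : nat -> R) d d' (c c' : R) :
  F n / beta R d n @[n --> \oo] --> c -> G n / beta R d' n @[n --> \oo] -->
    c' ->
  conv F G n / beta R (d + d').+1 n @[n --> \oo] --> c * c'.
Proof.
move=> Fc Gc'.
have bn0 e n : beta R e n != 0 by rewrite lt0r_neq0// beta_gt0.
have sub0 (H : nat -> R) e (a : R) : H n / beta R e n @[n --> \oo] --> a ->
    (H n - a * beta R e n) / beta R e n @[n --> \oo] --> 0.
  move=> Ha; rewrite -[0](subrr a).
  apply: (cvgn_near_eq (N := 0%N)) (cvgnB Ha (cvg_cst a)) => n _.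
  by rewrite mulrBl mulfK.
have [M M0 HM] := cvgn_bounded Gc'.
have GM n : `|G n| <= M * beta R d' n.
  by have := HM n; rewrite normrM normfV (gtr0_norm (beta_gt0 _ _ _))
    ler_pdivrMr ?beta_gt0.
have T1 := conv_beta_o (sub0 _ _ _ Fc) GM.
have bM n : `|c * beta R d n| <= `|c| * beta R d n.
  by rewrite normrM (gtr0_norm (beta_gt0 _ _ _)).
have T2 := conv_beta_o (sub0 _ _ _ Gc') bM.
have cc : c * c' @[_ --> \oo] --> c * c' by exact: cvg_cst.
have := cvgnD (cvgnD T1 T2) cc; rewrite !add0r.
apply: (cvgn_near_eq (N := 0%N)) => n _.
rewrite [(d' + d)%N]addnC -mulrDl -[c * c'](mulfK (bn0 (d + d').+1 n)) -mulrDl.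
congr (_ / _); rewrite -conv_beta.
have -> : c * c' * conv (beta R d) (beta R d') n =
   conv (fun k => c' * beta R d' k) (fun k => c * beta R d k) n.
  rewrite (convC (fun k => _)) /conv mulr_sumr; apply: eq_bigr => k _; ring.
rewrite -addrA [X in _ + X](_ : _ = conv G (fun k => c * beta R d k) n).
  rewrite (convC G) /conv -big_split/=; apply: eq_bigr => k _; ring.
rewrite /conv -big_split/=; apply: eq_bigr => k _; ring.
Qed.

Definition geo (R : realType) (L : R) (f : nat -> R) (n : nat) : R :=
  f n / L ^+ n.

Lemma conv_geoV (R : realType) (L : R) (f g : nat -> R) n :
  conv (geo L f) (geo L g) n = geo L (conv f g) n.
Proof.
rewrite /geo; have := conv_geo L^-1 f g n; rewrite exprVn => <-.
by congr (conv _ _ n); apply/funext => k; rewrite exprVn.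
Qed.

Lemma asym_geo (R : realType) (f : nat -> R) d (L c : R) : 
  asym f d L c <-> geo L f n / beta R d n @[n --> \oo] --> c.
Proof.
by split; apply: (cvgn_near_eq (N := 0%N)) => n _;
  rewrite /geo /scale invfM mulrA mulrAC.
Qed.

Lemma geo_ge0 (R : realType) (L : R) (f : nat -> R) n : 0 < L ->
  (forall n, 0 <= f n) -> 0 <= geo L f n.
Proof. by move=> L0 f0; rewrite divr_ge0 ?exprn_ge0// ltW. Qed.

(** A factor whose rescaled series converges to [Q] only multiplies the leading constant of [g] by
    [Q], which is positive unless [f] vanishes identically. *)
Lemma tame_conv_summable (R : realType) (f g : nat -> R) d (L c B : R) :
  0 < L -> 0 < c -> asym g d L c -> (forall n, 0 <= f n) ->
  (forall n, \sum_(k < n) geo L f k <= B) -> tame (conv f g).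
Proof.
move=> L0 c0 gc f0 fB.
have [Q [Qlim Qub]] := nonneg_series_cvg (fun k => geo_ge0 k L0 f0) fB.
have [fz|] := pselect (forall k, f k = 0).
  by left; exists 0%N => n _; rewrite /conv big1// => k _; rewrite fz mul0r.
move=> /existsNP[k /eqP fk]; right; exists d, L, (c * Q); split=> //.
  rewrite mulr_gt0//; apply: lt_le_trans (Qub k.+1).
  rewrite big_ord_recr/= ltr_wpDl ?sumr_ge0// => [i _|]; first exact: geo_ge0.
  by rewrite divr_gt0 ?exprn_gt0// lt_def fk f0.
apply/asym_geo.
have := conv_summable_beta (fun k => geo_ge0 k L0 f0) Qlim
  ((asym_geo _ _ _ _).1 gc).
by apply: (cvgn_near_eq (N := 0%N)) => n _; rewrite conv_geoV.
Qed.

Lemma bounded_by_geo (R : realType) (u : nat -> R) (C r : R) : 0 <= C ->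
  0 < r < 1 ->
  (forall n, u n <= C * r ^+ n) -> forall n, \sum_(k < n) u k <= C / (1 - r).
Proof.
move=> C0 /andP[r0 r1] H n.
apply: le_trans (_ : \sum_(k < n) C * r ^+ k <= _); first exact: ler_sum.
by rewrite -mulr_sumr ler_wpM2l// geo_sum_le// ltW.
Qed.

Lemma bounded_ev0 (R : realType) (u : nat -> R) N :
  (forall n, 0 <= u n) -> (forall n, (N <= n)%N -> u n = 0) ->
  forall n, \sum_(k < n) u k <= \sum_(k < N) u k.
Proof.
move=> u0 uN n; rewrite -!(big_mkord xpredT u).
have [nN|/ltnW Nn] := leqP n N.
  by rewrite [leRHS](@big_cat_nat _ _ _ n)//= lerDl sumr_ge0.
rewrite (@big_cat_nat _ _ _ N)//= [X in _ + X]big_nat_cond.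
by rewrite [X in _ + X]big1 ?addr0// => k /andP[/andP[/uN]].
Qed.

(** When the rates differ, the slower sequence is summable after rescaling by the faster rate. When
    they agree, both rescaled sequences are of polynomial order and the degrees combine as in
    [conv_beta]. *)
Lemma tame_conv (R : realType) (f g : nat -> R) :
  (forall n, 0 <= f n) -> (forall n, 0 <= g n) ->
  tame f -> tame g -> tame (conv f g).
Proof.
have ev0 (u v : nat -> R) : (forall n, 0 <= u n) -> 
    (exists N, forall n, (N <= n)%N -> u n = 0) -> tame v -> tame (conv u v).
  move=> u0 [N HN] [[N' HN']|[d [L [c [L0 c0 H]]]]].
    left; exists (N + N')%N => n Nn; rewrite /conv big1// => k _.
    have [/HN->|kN] := leqP N k; first by rewrite mul0r.
    by rewrite HN' ?mulr0//; move: kN Nn; clear; lia.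
  apply: (tame_conv_summable L0 c0 H u0).
  apply: (@bounded_ev0 _ _ N) => [n|n /HN]; first exact: geo_ge0.
  by rewrite /geo => ->; rewrite mul0r.
move=> f0 g0 [fe|[d [L [c [L0 c0 H]]]]] tg; first exact: ev0.
case: (tg) => [ge|[d' [L' [c' [L'0 c'0 H']]]]].
  by rewrite convC; apply: ev0 => //; right; exists d, L, c.
have lt (u v : nat -> R) e (M a : R) e' M' a' : (forall n, 0 <= u n) ->
  0 < M -> 0 < M' -> 0 < a' ->
    asym u e M a -> asym v e' M' a' -> M < M' -> tame (conv u v).
  move=> u0 M0 M'0 a'0 ua va MM'.
  have [|C [r [C0 r1 ur]]] := asym_decay _ ua (L' := M'); first by rewrite M0.
  apply: (tame_conv_summable M'0 a'0 va u0).
  apply: (bounded_by_geo C0 r1) => n; apply: le_trans (ur n).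
  by rewrite ler_pM2r ?invr_gt0 ?exprn_gt0// ler_norm.
have [LL|LL|LL] := ltgtP L L'.
- exact: lt H H' LL.
- by rewrite convC; exact: lt H' H LL.
- right; exists (d + d').+1, L, (c * c'); split=> //; first exact: mulr_gt0.
  apply/asym_geo; rewrite -LL in H'.
  have := conv_beta_asym ((asym_geo _ _ _ _).1 H) ((asym_geo _ _ _ _).1 H').
  by apply: (cvgn_near_eq (N := 0%N)) => n _; rewrite conv_geoV.
Qed.

(** * The renewal theorem *)

Section Renewal.
Variables (R : realType) (p : nat -> R) (B : R).
Hypotheses (p_ge0 : forall k, 0 <= p k) (p1_gt0 : 0 < p 1%N).
Hypothesis (p_sum : \sum_(k < n) p k @[n --> \oo] --> (1 : R)).
Hypothesis (p_mean : forall n, \sum_(k < n) k%:R * p k <= B).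

Let p_sum_le1 n : \sum_(k < n) p k <= 1.
Proof.
have nd : {homo (fun n => \sum_(k < n) p k) : m n / (m <= n)%N >-> m <= n}.
  by apply/nondecreasing_seqP => m; rewrite big_ord_recr/= lerDl.
have cq : cvgn (fun n => \sum_(k < n) p k) by apply/cvg_ex; exists 1.
by rewrite -(cvg_lim _ p_sum)//; exact: (nondecreasing_cvgn_le nd cq n).
Qed.

(** The tails of the probability distribution [p]; they sum to its mean, whence the bound [B]
    below. *)
Let q n := 1 - \sum_(k < n.+1) p k.

Let q_ge0 n : 0 <= q n. Proof. by rewrite subr_ge0. Qed.

(** Exchange of summation: [p j] is counted once for every [k < j], hence at most [j] times. The
    infinite tails are first cut at [m], then [m] goes to infinity. *)
Let q_sum_le n : \sum_(k < n) q k <= B.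
Proof.
have H m : \sum_(k < n) (\sum_(j < m) p j - \sum_(j < k.+1) p j) <= B.
  apply: le_trans (p_mean m).
  apply: (@le_trans _ _ (\sum_(k < n) \sum_(j < m) ((k < j)%N%:R * p j))).
    apply: ler_sum => k _; rewrite lerBlDr -(big_mkord xpredT p)
      -(big_mkord xpredT p).
    rewrite -(big_mkord xpredT (fun j => (k < j)%N%:R * p j)).
    have [mk|km] := leqP m k.+1.
      rewrite [X in _ <= _ + X](@big_cat_nat _ _ _ m)//= addrCA lerDl addr_ge0
        ?sumr_ge0//.
      by move=> j _; rewrite mulr_ge0.
    rewrite (@big_cat_nat _ _ _ k.+1) ?(ltnW km)//= addrC lerD//.
    rewrite [leRHS](@big_cat_nat _ _ _ k.+1) ?(ltnW km)//= -[leLHS]add0r lerD//.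
      by apply: sumr_ge0 => j _; rewrite mulr_ge0.
    rewrite big_nat [leRHS]big_nat; apply: ler_sum => j /andP[kj _].
    by rewrite kj mul1r.
  rewrite exchange_big/=; apply: ler_sum => j _; rewrite -mulr_suml.
  rewrite ler_wpM2r// -natr_sum ler_nat.
  rewrite -(big_mkord xpredT (fun k => ((k < j)%N : nat))).
  have [nj|jn] := leqP n j.
    apply: leq_trans (_ : \sum_(0 <= k < n) 1 <= _)%N;
      last by rewrite sum_nat_const_nat; lia.
    by apply: leq_sum => k _; case: (_ < _)%N.
  rewrite (@big_cat_nat _ _ _ j) ?(ltnW jn)//=.
  rewrite [X in (_ + X)%N]big_nat_cond [X in (_ + X)%N]big1 ?addn0.
    apply: leq_trans (_ : \sum_(0 <= k < j) 1 <= _)%N;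
      last by rewrite sum_nat_const_nat; lia.
    by apply: leq_sum => k _; case: (_ < _)%N.
  by move=> k /andP[/andP[jk _] _]; rewrite ltnNge jk.
apply: (cvgn_le_cst (N := 0%N) (fun m _ => H m)).
elim: (n) => [|k IH].
  by under eq_fun do rewrite big_ord0; rewrite big_ord0; exact: cvg_cst.
under eq_fun do rewrite big_ord_recr/=; rewrite big_ord_recr/=.
by apply: cvgnD => //; apply: cvgnB => //; exact: cvg_cst.
Qed.

Let q0 : p 0%N = 0 -> q 0%N = 1.
Proof. by move=> p0; rewrite /q big_ord_recl big_ord0 p0 !addr0 subr0. Qed.

(* [L] is the limit superior of [v]; as [p 1 > 0], a value close to it forces
   the previous values to be close to it as well. *)
Let limsup_back (v : nat -> R) :
  (forall n, 0 <= v n <= 1) -> v n - conv p v n @[n --> \oo] --> 0 ->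
  exists L, [/\ 0 <= L, (forall eta, 0 < eta -> exists N, forall n,
    (N <= n)%N -> v n <= L + eta) &
   forall k eta, 0 < eta -> exists n, (k <= n)%N /\ forall j, (j <= k)%N ->
     L - eta <= v (n - j)%N].
Proof.
move=> v01 vp.
pose S := [set y | exists N, forall n, (N <= n)%N -> v n <= y].
have S1 : S 1 by exists 0%N => n _; case/andP: (v01 n).
have Sl : lbound S 0.
  by move=> y [N /(_ N (leqnn N))]; apply: le_trans; case/andP: (v01 N).
have hS : has_inf S by split; [exists 1|exists 0].
have L0 : 0 <= inf S by apply: lb_le_inf => //; exists 1.
have up eta : 0 < eta -> exists N, forall n, (N <= n)%N -> v n <= inf S + eta.
  move=> e0; have [y [N HN] yl] := inf_adherent e0 hS.
  by exists N => n Nn; exact: le_trans (HN n Nn) (ltW yl).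
have freq eta N : 0 < eta -> exists2 n, (N <= n)%N & inf S - eta <= v n.
  move=> e0; apply: contrapT => H.
  have : S (inf S - eta).
    exists N => n Nn; apply/ltW; rewrite ltNge; apply/negP => Hn.
    by apply: H; exists n.
  by move=> /(ge_inf hS.2); rewrite leNgt gtrBl e0.
exists (inf S); split=> //; set L := inf S in L0 up freq *.
have back eta : 0 < eta -> exists eta' N', [/\ 0 < eta', eta' <= eta &
    forall n, (N' <= n)%N -> L - eta' <= v n -> L - eta <= v n.-1].
  (* Four errors of size [h] add up: in the lower bound on [v n], in [v n - conv p v n], in the mass
     of [p] beyond [K], and in the upper bound [L + h] on earlier values. Their total must not
     exceed [p 1 * eta]. *)
  move=> e0; pose h := Num.min eta (p 1%N * eta / 4).
  have h0 : 0 < h by rewrite lt_min e0 !divr_gt0 ?mulr_gt0.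
  have hp : h * 4 <= p 1%N * eta by rewrite -ler_pdivlMr// ge_min lexx orbT.
  have [N0 HN0] := up h h0.
  have [K HK] := (cvgn_distP _ _).1 p_sum h h0.
  have [N1 HN1] := (cvgn_distP _ _).1 vp h h0.
  exists h, (N0 + K + N1 + 1)%N; split=> //; first by rewrite ge_min lexx.
  move=> n nN Ln.
  have n1 : (1 < n.+1)%N by lia.
  have E : conv p v n = p 1%N * v n.-1 + \sum_(k < n.+1 | k != Ordinal n1) p k
    * v (n - k)%N.
    by rewrite /conv (bigD1 (Ordinal n1))//= subn1.
  have E2 : \sum_(k < n.+1 | k != Ordinal n1) p k * v (n - k)%N <=
     \sum_(k < n.+1 | k != Ordinal n1) p k * (L + h) + \sum_(k < n.+1)
       (K <= k)%N%:R * p k.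
    rewrite [X in _ <= _ + X](bigD1 (Ordinal n1))//= addrCA -[leLHS]add0r.
    apply: lerD; first by rewrite mulr_ge0.
    rewrite -big_split/=; apply: ler_sum => k _.
    have [Kk|kK] := leqP K k; last first.
      by rewrite mul0r addr0 ler_wpM2l// HN0//; lia.
    rewrite mul1r -{3}[p k]mulr1 -mulrDr ler_wpM2l//.
    have /andP[_ v1] := v01 (n - k)%N; lra.
  have E3 : \sum_(k < n.+1) (K <= k)%N%:R * p k <= h.
    rewrite -(big_mkord xpredT (fun k => (K <= k)%N%:R * p k)).
    have Kn : (K <= n.+1)%N by lia.
    rewrite (@big_cat_nat _ _ _ K)//= [X in X + _]big_nat_cond [X in X + _]big1
      ?add0r; last first.
      by move=> k /andP[/andP[_ kK] _]; rewrite leqNgt kK mul0r.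
    have := HK K (leqnn K); have := p_sum_le1 n.+1.
    rewrite -(big_mkord xpredT p) (@big_cat_nat _ _ _ K)//= big_mkord.
    rewrite [X in _ -> _ -> X <= _](_ : _ = \sum_(K <= k < n.+1) p k);
      last first.
      by rewrite big_nat [RHS]big_nat; apply: eq_bigr => k /andP[-> _];
        rewrite mul1r.
    by rewrite ler_norml => H1 /andP[H2 _]; lra.
  have E4 : \sum_(k < n.+1 | k != Ordinal n1) p k * (L + h) <= (1 - p 1%N) *
    (L + h).
    rewrite -mulr_suml ler_wpM2r ?addr_ge0// ?(ltW h0)// lerBrDl.
    by have := p_sum_le1 n.+1; rewrite (bigD1 (Ordinal n1)).
  have : v n <= h + conv p v n.
    have := HN1 n; rewrite subr0 ler_norml => /(_ _)/andP[|_]; [lia|lra].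
  rewrite E => E5.
  have : p 1%N * (L - eta) <= p 1%N * v n.-1 by nra.
  by rewrite ler_pM2l.
(* Iteration of [back]: each further step back needs a smaller tolerance at the starting index. *)
have many k : forall eta, 0 < eta -> exists eta' N', [/\ 0 < eta', eta' <= eta &
    forall n, (N' <= n)%N -> L - eta' <= v n -> forall j, (j <= k)%N ->
      L - eta <= v (n - j)%N].
  elim: k => [|k IH] eta e0.
    by exists eta, 0%N; split=> // n _ Ln j; rewrite leqn0 => /eqP->;
      rewrite subn0.
  have [e1 [N1 [e10 e1e H1]]] := IH eta e0.
  have [e2 [N2 [e20 e2e H2]]] := back e1 e10.
  exists e2, (N1 + N2 + 1)%N; split=> //; first exact: le_trans e1e.
  move=> n nN Ln [_|j jk].
    by rewrite subn0; apply: le_trans Ln; rewrite lerB// (le_trans e2e).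
  have -> : (n - j.+1 = n.-1 - j)%N by lia.
  by apply: H1 => //; [lia|apply: H2 => //; lia].
move=> k eta e0; have [e1 [N1 [e10 e1e H1]]] := many k eta e0.
have [n nN Ln] := freq e1 (k + N1)%N e10.
by exists n; split; [lia|apply: H1 => //; lia].
Qed.

(** On a long window where [v] is close to its limit superior [L], the bound on [conv q v] shows
    that [L] times a partial sum of [q] is at most [E], up to a small error; longer windows give
    [L * Q <= E]. *)
Let limsup_le (Q : R) (v : nat -> R) (E : R) : 1 <= Q ->
  \sum_(k < n) q k @[n --> \oo] --> Q ->
  (forall n, 0 <= v n <= 1) -> v n - conv p v n @[n --> \oo] --> 0 ->
  (forall n, conv q v n <= E) ->
  forall eta, 0 < eta -> exists N, forall n, (N <= n)%N -> v n <= E / Q + eta.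
Proof.
move=> Q1 qQ v01 vp qE.
have [L [L0 up bk]] := limsup_back v01 vp.
have Q0 : 0 < Q by exact: lt_le_trans Q1.
suff LE : L <= E / Q.
  by move=> eta /up[N HN]; exists N => n /HN; move: LE; lra.
rewrite ler_pdivlMr//.
apply: (cvgn_le_cst (N := 0%N) (u := fun n => L * \sum_(k < n) q k));
  last exact: cvgnZ.
move=> [_|K _].
  rewrite big_ord0 mulr0; apply: le_trans (qE 0%N); apply: conv_ge0 => // n.
  by case/andP: (v01 n).
apply/ler_addgt0Pr => eps e0.
have s0 : 0 <= \sum_(k < K.+1) q k by exact: sumr_ge0.
have e1 : 0 < eps / (\sum_(k < K.+1) q k + 1) by rewrite divr_gt0// ltr_wpDl.
have [n [Kn Hn]] := bk K _ e1.
have hs : eps / (\sum_(k < K.+1) q k + 1) * \sum_(k < K.+1) q k <= eps.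
  by rewrite -mulrA ger_pMr// mulrC ler_pdivrMr ?ltr_wpDl// mul1r lerDl.
move: e1 Hn hs; move: (eps / _) => h e1 Hn hs.
have : (L - h) * \sum_(k < K.+1) q k <= E.
  apply: le_trans (qE n); rewrite /conv -(big_mkord xpredT q) mulr_sumr.
  rewrite -(big_mkord xpredT (fun k => q k * v (n - k)%N)).
  have Kn1 : (K.+1 <= n.+1)%N by [].
  rewrite [leRHS](@big_cat_nat _ _ _ K.+1)//= -[leLHS]addr0; apply: lerD.
    rewrite big_nat [leRHS]big_nat; apply: ler_sum => k /andP[_ kK].
    by rewrite [leLHS]mulrC ler_wpM2l// Hn.
  rewrite big_nat_cond sumr_ge0// => k _; rewrite mulr_ge0//.
  by case/andP: (v01 (n - k)%N).
nra.
Qed.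

(** The tails satisfy [conv q u = 1], so [limsup_le] bounds the upper limit of [u] by [1 / Q]. The
    same bound for [v = 1 - u], where [conv q v <= Q - 1], shows that the lower limit of [u] is at
    least [1 / Q]. *)
Lemma renewal (u : nat -> R) : p 0%N = 0 -> u = @delta0 R \+ conv p u ->
  (forall n, 0 <= u n) -> exists2 c : R, 0 < c & u n @[n --> \oo] --> c.
Proof.
move=> p0 uE u_ge0.
have uEn n : u n = @delta0 R n + conv p u n by rewrite {1}uE.
have [Q [qQ qQle]] := nonneg_series_cvg q_ge0 q_sum_le.
have Q1 : 1 <= Q by have := qQle 1%N; rewrite big_ord_recl big_ord0 addr0 q0.
have u1 n : u n <= 1.
  have [m] := ubnP n; elim: m n => // m IH [|n] nm.
    by rewrite uEn /conv big_ord_recl big_ord0 p0 mul0r !addr0.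
  rewrite uEn /delta0 add0r; apply: le_trans (p_sum_le1 n.+2).
  apply: ler_sum => -[[|k] kn] _ /=; first by rewrite p0 mul0r.
  by rewrite -[leRHS]mulr1 ler_wpM2l// IH//; lia.
have qu n : conv q u n = 1.
  (* In generating functions, [q] is [(1 - p) / (1 - t)] and [u] is [1 / (1 - p)], so their product
     is [1 / (1 - t)]. *)
  have -> : q = conv (beta R 0) (fun k => @delta0 R k - p k).
    apply/funext => k; rewrite /conv.
    under eq_bigr do rewrite beta0 mul1r.
    rewrite (reindex_inj rev_ord_inj)/=.
    under eq_bigr => i _ do rewrite subSS subKn -1?ltnS//.
    by rewrite big_split/= sumrN big_ord_recl big1 ?addr0.
  rewrite -convA.
  have -> : conv (fun k => @delta0 R k - p k) u = @delta0 R.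
    apply/funext => k.
    have -> : (fun k => @delta0 R k - p k) = @delta0 R \+ (-1) \*o p.
      by apply/funext => j /=; rewrite mulN1r.
    by rewrite convDl conv_delta0l convZl/= mulN1r uEn addrK.
  by rewrite convC conv_delta0l beta0.
have d0 : @delta0 R n @[n --> \oo] --> 0.
  by apply: (@cvgn_near_eq _ (fun=> 0) _ _ 1%N) => [[]//|]; exact: cvg_cst.
have up : u n - conv p u n @[n --> \oo] --> 0.
  by apply: (cvgn_near_eq (N := 0%N)) d0 => n _; rewrite uEn addrK.
have u01 n : 0 <= u n <= 1 by rewrite u_ge0 u1.
have uq n : conv q u n <= 1 by rewrite qu.
have H1 := limsup_le Q1 qQ u01 up uq.
pose v n := 1 - u n.
have v01 n : 0 <= v n <= 1 by rewrite subr_ge0 u1 lerBlDr lerDl u_ge0.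
have conv1 f n : conv f v n = \sum_(k < n.+1) f k - conv f u n.
  by rewrite /conv -sumrB; apply: eq_bigr => k _; rewrite mulrBr mulr1.
have vp : v n - conv p v n @[n --> \oo] --> 0.
  have ps : \sum_(k < n.+1) p k @[n --> \oo] --> (1 : R).
    by rewrite (cvg_shiftS (fun n => \sum_(k < n) p k)).
  have one : (1 : R) @[_ --> \oo] --> (1 : R) by exact: cvg_cst.
  have := cvgnB (cvgnB one ps) up; rewrite subrr subr0.
  by apply: (cvgn_near_eq (N := 0%N)) => n _; rewrite conv1 /v; ring.
have vE n : conv q v n <= Q - 1 by rewrite conv1 qu lerD2r.
have H2 := limsup_le Q1 qQ v01 vp vE.
have Q0 : 0 < Q by exact: lt_le_trans Q1.
exists Q^-1; first by rewrite invr_gt0.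
apply/cvgn_distP => eps e0.
have [N1 HN1] := H1 eps e0; have [N2 HN2] := H2 eps e0.
exists (maxn N1 N2) => n; rewrite geq_max => /andP[/HN1 + /HN2].
by rewrite /v mulrBl divff ?lt0r_neq0// mul1r ler_norml; lra.
Qed.

End Renewal.

(** * A point where a power series takes the value one *)

Lemma subX_le (R : realType) (x y : R) k : 0 <= x <= y ->
  y ^+ k - x ^+ k <= k%:R * y ^+ k.-1 * (y - x).
Proof.
move=> /andP[x0 xy]; have y0 := le_trans x0 xy.
case: k => [|k]; first by rewrite subrr !mul0r.
rewrite subrXX mulrC ler_wpM2r ?subr_ge0//=.
rewrite mulr_natl -[k.+1 in leRHS]card_ord -sumr_const.
apply: ler_sum => i _ /=.
have -> : y ^+ k = y ^+ (k - i) * y ^+ i by rewrite -exprD subnK// -ltnS.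
by rewrite ler_wpM2l ?exprn_ge0// lerXn2r ?nnegrE.
Qed.

Lemma bernoulli_le (R : realType) (x : R) n : 0 <= x <= 1 ->
  1 - n%:R * x <= (1 - x) ^+ n.
Proof.
move=> /andP[x0 x1]; elim: n => [|n IH]; first by rewrite mul0r subr0.
rewrite exprS; apply: le_trans (ler_wpM2l _ IH); last by rewrite subr_ge0.
by rewrite -natr1; have := ler0n R n; nra.
Qed.

(** The root is the supremum [s] of the points where all partial sums are at most 1. The bound on
    the first moments makes all partial sums Lipschitz with constant [B / r]; so the sum at [s] is
    at most 1, and if it were smaller, a slightly larger point would qualify. *)
Lemma series_root (R : realType) (g : nat -> R) (r B : R) K :
  (forall k, 0 <= g k) -> g 0%N = 0 -> 0 < r ->
  (forall n, \sum_(k < n) k%:R * (g k * r ^+ k) <= B) ->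
  1 <= \sum_(k < K) g k * r ^+ k ->
  exists2 s : R, 0 < s <= r & \sum_(k < n) g k * s ^+ k @[n --> \oo] -->
    (1 : R).
Proof.
move=> g_ge0 g0 r0 gB gK; pose S x n := \sum_(k < n) g k * x ^+ k.
have B0 : 0 <= B by have := gB 0%N; rewrite big_ord0.
have SL x y n : 0 <= x <= y -> y <= r -> S y n <= S x n + B / r * (y - x).
  move=> /[dup] xy' /andP[x0 xy] yr; rewrite addrC -lerBlDr -sumrB.
  have y0 := le_trans x0 xy.
  apply: le_trans (_ : (\sum_(k < n) k%:R * (g k * r ^+ k)) / r * (y - x) <=
    _); last first.
    by rewrite ler_wpM2r ?subr_ge0// ler_pM2r ?invr_gt0.
  rewrite !mulr_suml; apply: ler_sum => -[k _] _ /=; rewrite -mulrBr.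
  apply: le_trans (ler_wpM2l (g_ge0 k) (subX_le k xy')) _.
  rewrite [leLHS]mulrA; apply: ler_wpM2r; first by rewrite subr_ge0.
  case: k => [|k]; first by rewrite g0 !mul0r.
  rewrite [leLHS]mulrCA -!mulrA; apply: ler_wpM2l => //;
    apply: ler_wpM2l => //=.
  by rewrite exprS mulrAC divff ?lt0r_neq0// mul1r lerXn2r ?nnegrE// ltW.
pose E := [set x | 0 <= x <= r /\ forall n, S x n <= 1].
have E0 : E 0.
  split; first by rewrite lexx ltW.
  move=> n; rewrite /S big1// => -[[|k] _] _ /=; first by rewrite g0 mul0r.
  by rewrite exprS mul0r mulr0.
have Eub : ubound E r by move=> x [/andP[]].
have hE : has_sup E by split; [exists 0|exists r].
pose s := sup E.
have s0 : 0 <= s by exact: (ub_le_sup hE.2).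
have sr : s <= r by apply: ge_sup => //; exists 0.
have S1 n : S s n <= 1.
  apply/ler_addgt0Pr => eps e0.
  have e1 : 0 < eps / (B / r + 1) by rewrite divr_gt0// ltr_wpDl// divr_ge0//
    ltW.
  have [x [/andP[x0 xr] Sx] xs] := sup_adherent e1 hE.
  have xs' : x <= s by apply: (ub_le_sup hE.2); split=> //; rewrite x0.
  apply: le_trans (SL x s n _ sr) _; first by rewrite x0.
  apply: lerD => //.
  apply: le_trans (_ : B / r * (eps / (B / r + 1)) <= _).
    by rewrite ler_wpM2l ?divr_ge0 ?(ltW r0)//; rewrite -/s in xs; lra.
  rewrite mulrCA ger_pMr// ler_pdivrMr ?mul1r ?lerDl//.
  by rewrite ltr_wpDl// divr_ge0// ltW.
have Sge n : 0 <= g n * s ^+ n by rewrite mulr_ge0 ?exprn_ge0.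
have [Q [qQ qle]] := nonneg_series_cvg Sge S1.
have Q1 : Q <= 1 by apply: (cvgn_le_cst (N := 0%N)) qQ => n _; exact: S1.
suff Q1' : 1 <= Q.
  exists s; last by have -> : (1 : R) = Q by apply/le_anti; rewrite Q1' Q1.
  rewrite sr andbT lt_def s0 andbT; apply/negP => /eqP sz.
  have : Q <= 0; last by lra.
  apply: (cvgn_le_cst (N := 0%N)) qQ => n _.
  rewrite big1// => -[[|k] _] _ /=; first by rewrite g0 mul0r.
  by rewrite sz exprS mul0r mulr0.
rewrite leNgt; apply/negP => Ql.
have [srl|rs] := ltP s r; last first.
  have sE : s = r by apply/le_anti; rewrite sr rs.
  by have := le_lt_trans (qle K) Ql; rewrite sE; lra.
(* A step short enough not to leave [[0, r]] and to increase the partial sums by at most [1 - Q]. *)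
pose h := Num.min (r - s) ((1 - Q) / (B / r + 1)).
have B1 : 0 < B / r + 1 by rewrite ltr_wpDl// divr_ge0// ltW.
have h0 : 0 < h by rewrite lt_min subr_gt0 srl divr_gt0// subr_gt0.
have hr : h <= r - s by rewrite ge_min lexx.
have hB : h * (B / r + 1) <= 1 - Q by rewrite -ler_pdivlMr// ge_min lexx orbT.
have : E (s + h).
  split; first by rewrite addr_ge0 ?(ltW h0)//=; lra.
  move=> n; apply: le_trans (SL s (s + h) n _ _) _; [|lra|].
    by rewrite s0 lerDl ltW.
  have := qle n; rewrite -/(S s n) addrAC subrr add0r.
  by rewrite mulrDr mulr1 mulrC in hB; lra.
by move=> /(ub_le_sup hE.2); rewrite -/s; lra.
Qed.

(** * Renewal sequences *)

(* [star g] is the sum of the convolution powers of [g]; [star_seq g n] lists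
   its values from [n] down to [0]. *)
Fixpoint star_seq (R : realType) (g : nat -> R) (n : nat) : seq R :=
  if n is m.+1 then
    let s := star_seq g m in (\sum_(k < m.+1) g k.+1 * s`_k) :: s
  else [:: 1].

Definition star (R : realType) (g : nat -> R) (n : nat) : R :=
  (star_seq g n)`_0.

Lemma nth_star_seq (R : realType) (g : nat -> R) n k :
  (k <= n)%N -> (star_seq g n)`_k = star g (n - k).
Proof.
by elim: n k => [|n IH] [|k]//; rewrite ltnS subSS => /IH.
Qed.

Lemma starE (R : realType) (g : nat -> R) : g 0%N = 0 ->
  star g = @delta0 R \+ conv g (star g).
Proof.
move=> g0; apply/funext => -[|n] /=.
  by rewrite /star/= /conv big_ord_recl big_ord0 g0 mul0r !addr0.
rewrite /delta0 add0r convS0// /star/=.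
by apply: eq_bigr => k _; rewrite nth_star_seq// -ltnS.
Qed.

Lemma star_ge0 (R : realType) (g : nat -> R) n : (forall k, 0 <= g k) ->
  0 <= star g n.
Proof.
move=> g_ge0; have [m] := ubnP n; elim: m n => // m IH [|n] nm;
  first by rewrite /star/=.
rewrite /star/=; apply: sumr_ge0 => k _;
  rewrite mulr_ge0// nth_star_seq -1?ltnS// IH//.
by lia.
Qed.

(** If the series of [g] takes the value 1 at [s], then [star g n * s ^ n] solves the renewal
    equation for the distribution [g k * s ^ k], so it has a positive limit. It remains to find a
    radius [r] at which the series reaches 1 while its first moments stay bounded. *)
Lemma tame_star (R : realType) (g : nat -> R) :
  (forall n, 0 <= g n) -> g 0%N = 0 -> 0 < g 1%N -> tame g -> tame (star g).
Proof.
move=> g_ge0 g0 g1 tg.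
suff [r [B [K [r0 gB gK]]]] : exists (r B : R) K, [/\ 0 < r,
    forall n, \sum_(k < n) k%:R * (g k * r ^+ k) <= B &
    1 <= \sum_(k < K) g k * r ^+ k].
  have [s /andP[s0 sr] gs] := series_root g_ge0 g0 r0 gB gK.
  pose p k := g k * s ^+ k.
  have p_ge0 k : 0 <= p k by rewrite mulr_ge0 ?exprn_ge0 ?(ltW s0).
  have p1 : 0 < p 1%N by rewrite mulr_gt0.
  have pB n : \sum_(k < n) k%:R * p k <= B.
    apply: le_trans (gB n); apply: ler_sum => k _;
      rewrite ler_wpM2l// ler_wpM2l//.
    by rewrite lerXn2r ?nnegrE// ltW.
  pose u k := star g k * s ^+ k.
  have uE : u = @delta0 R \+ conv p u.
    apply/funext => n; rewrite /= conv_geo /u {1}starE//= mulrDl; congr (_ + _).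
    by rewrite /delta0; case: n => [|n]; rewrite ?mul1r ?expr0// mul0r.
  have [||c c0 uc] := renewal p_ge0 p1 gs pB _ uE.
  - by rewrite /p g0 mul0r.
  - by move=> n; rewrite mulr_ge0 ?star_ge0// exprn_ge0// ltW.
  right; exists 0%N, s^-1, c; split=> //; first by rewrite invr_gt0.
  apply: (cvgn_near_eq (N := 0%N)) uc => n _.
  by rewrite /scale beta0 mul1r exprVn invrK.
case: tg => [[N HN]|[d [L [c [L0 c0 H]]]]].
  (* At radius [1 / g 1] the term of index 1 alone equals 1. *)
  exists (g 1%N)^-1, (\sum_(k < N) k%:R * (g k * (g 1%N)^-1 ^+ k)), 2%N.
  split; first by rewrite invr_gt0.
    apply: (@bounded_ev0 _ (fun k => k%:R * (g k * (g 1%N)^-1 ^+ k))) =>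
      [k|k /HN ->].
      by rewrite !mulr_ge0 ?exprn_ge0// invr_ge0 ltW.
    by rewrite mul0r mulr0.
  rewrite !big_ord_recl big_ord0 g0 mul0r add0r addr0 expr1.
  by rewrite divff// lt0r_neq0.
have c2 : 0 < c / 2 by rewrite divr_gt0.
have [N HN] := (cvgn_distP _ _).1 H _ c2.
have gL n : (N <= n)%N -> c / 2 * L ^+ n <= g n.
  move=> Nn; have := HN n Nn; rewrite ler_norml => /andP[H1 _].
  have : c / 2 <= g n / scale d L n by lra.
  rewrite ler_pdivlMr ?scale_gt0//; apply: le_trans;
    rewrite ler_wpM2l ?(ltW c2)//.
  by rewrite /scale ler_peMl ?beta_ge1// exprn_ge0// ltW.
(* At radius [t / L], the terms with indices from [N] to [K - 1] will be at least [c / 4], so that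
   [m >= 4 / c] of them suffice to reach 1. *)
pose m := (Num.trunc (4 / c)).+1.
have mc : 4 / c <= m%:R by apply/ltW; rewrite /m truncnS_gt.
pose K := (N + m)%N.
have K0 : 0 < K%:R :> R by rewrite ltr0n /K /m; lia.
(* Being below 1, [t] leaves a geometric decay that bounds the moments; by Bernoulli's inequality
   [t ^ K >= 1 / 2], so the terms before [K] lose at most a factor 2. *)
pose t : R := 1 - (2 * K%:R)^-1.
have K1 : 1 <= K%:R :> R by rewrite ler1n /K /m; lia.
have i0 : 0 < (2 * K%:R)^-1 :> R by rewrite invr_gt0; lra.
have i1 : (2 * K%:R)^-1 <= 1 / 2 :> R by rewrite invf_ple ?posrE; lra.
have t0 : 0 < t by rewrite /t; lra.
have t1 : t < 1 by rewrite /t; lra.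
have tK : 1 / 2 <= t ^+ K.
  apply: le_trans (bernoulli_le K _); last by lra.
  rewrite invfM mulrCA divff ?lt0r_neq0// mulr1; lra.
have r0 : 0 < t / L by rewrite divr_gt0.
have [|C [w [C0 w1 gw]]] := asym_decay _ H (L' := (t / L)^-1).
  by rewrite L0/= invf_div ltr_pdivlMr// gtr_pMr.
have [C' [w' [C'0 w'1 Hw]]] := @beta_geo_decay R 1 w w1.
exists (t / L), (C * C' / (1 - w')), K; split=> //.
  apply: (@bounded_by_geo _ (fun k => k%:R * (g k * (t / L) ^+ k))) => // [|k].
    exact: mulr_ge0.
  have := gw k; rewrite ger0_norm// exprVn invrK => gwk.
  apply: le_trans (ler_wpM2l (ler0n R k) gwk) _.
  rewrite mulrCA -mulrA ler_wpM2l//; apply: le_trans (Hw k).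
  have /andP[w0 _] := w1.
  by rewrite ler_wpM2r ?exprn_ge0 ?(ltW w0)// /beta bin1 ler_nat leq_addr.
rewrite -(big_mkord xpredT (fun k => g k * (t / L) ^+ k)).
rewrite (@big_cat_nat _ _ _ N) ?leq_addr//= -[leLHS]add0r; apply: lerD.
  by apply: sumr_ge0 => k _; rewrite mulr_ge0// exprn_ge0// ltW.
apply: le_trans (_ : \sum_(N <= k < K) c / 4 <= _).
  rewrite sumr_const_nat /K addKn -mulr_natr.
  by rewrite ler_pdivrMr// in mc; nra.
rewrite [leLHS]big_nat [leRHS]big_nat; apply: ler_sum => k /andP[Nk kK].
have Lk : 0 < L ^+ k by rewrite exprn_gt0.
apply: le_trans (_ : c / 2 * L ^+ k * (t / L) ^+ k <= _); last first.
  by rewrite ler_wpM2r ?gL// exprn_ge0// ltW.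
rewrite -[leRHS]mulrA expr_div_n [L ^+ k * _]mulrCA divff ?lt0r_neq0// mulr1.
have : t ^+ K <= t ^+ k by apply: ler_wiXn2l;
  [exact: ltW|exact: ltW|exact: ltnW].
nra.
Qed.

(** * Powers of a nonnegative matrix *)

Lemma conv_0 (R : realType) (f g : nat -> R) : conv f g 0%N = f 0%N * g 0%N.
Proof. by rewrite /conv big_ord_recl big_ord0 addr0. Qed.

Lemma conv_suml (R : realType) (T : Type) (s : seq T) (f : T -> nat -> R)
  (h : nat -> R) n :
  conv (fun k => \sum_(x <- s) f x k) h n = \sum_(x <- s) conv (f x) h n.
Proof.
rewrite /conv exchange_big/=; apply: eq_bigr => k _; exact: mulr_suml.
Qed.

Definition delta1 (R : realType) (n : nat) : R := (n == 1%N)%:R.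

Lemma conv_delta1l (R : realType) (f : nat -> R) n :
  conv (@delta1 R) f n = if n is m.+1 then f m else 0.
Proof.
case: n => [|n]; first by rewrite /conv big_ord_recl big_ord0 mul0r addr0.
rewrite convS0// big_ord_recl subn0 mul1r big1 ?addr0// => k _.
by rewrite mul0r.
Qed.

Section Paths.
Variables (R : realType) (I : finType) (A : I -> I -> R).

Fixpoint mpow (n : nat) (i j : I) : R :=
  if n is m.+1 then \sum_k A i k * mpow m k j else (i == j)%:R.

Lemma mpowD m n i j : mpow (m + n) i j = \sum_k mpow m i k * mpow n k j.
Proof.
elim: m i => [|m IH] i /=.
  rewrite (bigD1 i)//= eqxx mul1r big1 ?addr0// => k /negbTE.
  by rewrite eq_sym => ->; rewrite mul0r.
under eq_bigr do rewrite IH mulr_sumr.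
rewrite exchange_big; apply: eq_bigr => k _ /=; rewrite mulr_suml.
by apply: eq_bigr => l _; rewrite mulrA.
Qed.

(* The total weight of the walks of length [n >= 1] from [i] to [j] whose
   intermediate vertices lie in [s], computed by eliminating one vertex at a
   time. *)
Fixpoint walks (s : seq I) (i j : I) : nat -> R :=
  if s is x :: s' then
    walks s' i j \+
    conv (walks s' i x) (conv (star (walks s' x x)) (walks s' x j))
  else A i j \*o @delta1 R.

Lemma walks_cons x s i j : walks (x :: s) i j =
  walks s i j \+ conv (walks s i x) (conv (star (walks s x x)) (walks s x j)).
Proof. by []. Qed.

Lemma walks0 s i j : walks s i j 0%N = 0.
Proof.
elim: s i j => [|x s IH] i j /=; first by rewrite /delta1 mulr0.
by rewrite IH add0r conv_0 IH mul0r.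
Qed.

Lemma walks1 s i j : walks s i j 1%N = A i j.
Proof.
elim: s i j => [|x s IH] i j /=; first by rewrite /delta1 mulr1.
rewrite IH {1}/conv !big_ord_recl big_ord0 walks0 mul0r add0r addr0.
by rewrite subnn conv_0 walks0 !mulr0 addr0.
Qed.

(** Elimination agrees with the decomposition of walks by their first step; with all vertices in
    [s], this is the recursion of the matrix powers. *)
Lemma walks_conv s i j : walks s i j =
  (fun n => A i j * @delta1 R n +
            \sum_(x <- s) A i x * conv (@delta1 R) (walks s x j) n).
Proof.
elim: s i j => [|y s IH] i j.
  by apply/funext => n; rewrite big_nil addr0.
(* [V] is [walks (y :: s) y j]: any number of returns to [y], then a walk to [j] that avoids [y] in
   between; [VE] is its first-return equation. *)
pose V := conv (star (walks s y y)) (walks s y j).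
have VE : V = walks s y j \+ conv (walks s y y) V.
  rewrite {1}/V starE ?walks0// convDl conv_delta0l /V.
  by rewrite convA.
have GV k : walks (y :: s) k j = walks s k j \+ conv (walks s k y) V by [].
apply/funext => n; rewrite GV/= {1}IH.
have -> : conv (walks s i y) V n = A i y * conv (@delta1 R) V n +
    \sum_(x <- s) A i x * conv (@delta1 R) (conv (walks s x y) V) n.
  rewrite {1}[walks s i y]IH.
  have -> : (fun n => A i y * @delta1 R n +
      \sum_(x <- s) A i x * conv (@delta1 R) (walks s x y) n) =
    (A i y \*o @delta1 R) \+
      (fun n => \sum_(x <- s) (A i x \*o conv (@delta1 R) (walks s x y)) n) by
        [].
  rewrite convDl /= convZl/=; congr (_ + _); rewrite conv_suml.
  by apply: eq_bigr => x _; rewrite convZl/= convA.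
rewrite big_cons -/V -VE -addrA; congr (_ + _).
rewrite addrCA; congr (_ + _); rewrite -big_split/=.
by apply: eq_bigr => x _; rewrite -/V convDr/= mulrDr.
Qed.

Lemma walksS s i j n : walks s i j n.+1 =
  A i j * (n == 0%N)%:R + \sum_(x <- s) A i x * walks s x j n.
Proof.
rewrite {1}walks_conv; congr (_ + _).
by apply: eq_bigr => x _; rewrite conv_delta1l.
Qed.

Lemma walks_mpow i j n : walks (enum I) i j n.+1 = mpow n.+1 i j.
Proof.
elim: n i j => [|n IH] i j; rewrite walksS.
  rewrite /= mulr1 big1 ?addr0 => [|x _]; last by rewrite walks0 mulr0.
  rewrite (bigD1 j)//= eqxx mulr1 big1 ?addr0// => k /negbTE ->.
  by rewrite mulr0.
by rewrite mulr0 add0r big_enum; apply: eq_bigr => x _; rewrite IH.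
Qed.

Hypothesis A_ge0 : forall i j, 0 <= A i j.

Lemma mpow_ge0 n i j : 0 <= mpow n i j.
Proof.
elim: n i => [|n IH] i /=; first by rewrite ler0n.
by apply: sumr_ge0 => k _; exact: mulr_ge0.
Qed.

Lemma walks_ge0 s i j n : 0 <= walks s i j n.
Proof.
elim: s i j n => [|x s IH] i j n /=; first by rewrite mulr_ge0 ?ler0n.
rewrite addr_ge0// conv_ge0// => m; rewrite conv_ge0// => k.
by rewrite star_ge0.
Qed.

Lemma mpow_gt0D m n i k j : 0 < mpow m i k -> 0 < mpow n k j ->
  0 < mpow (m + n) i j.
Proof.
move=> ik kj; rewrite mpowD (bigD1 k)//= ltr_wpDr ?mulr_gt0//.
by apply: sumr_ge0 => l _; rewrite mulr_ge0 ?mpow_ge0.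
Qed.

Lemma mpow_gt0P m n i j : 0 < mpow (m + n) i j ->
  exists k, 0 < mpow m i k /\ 0 < mpow n k j.
Proof.
move=> ij; apply: contrapT => H; suff : mpow (m + n) i j = 0 by move=> E;
  rewrite E ltxx in ij.
rewrite mpowD big1// => k _; apply/eqP; rewrite -[_ == _]negbK;
  apply/negP => nz.
apply: H; exists k; rewrite !lt_def !mpow_ge0 !andbT.
by split; apply: contra nz => /eqP ->; rewrite ?mul0r ?mulr0.
Qed.

Section Transitive.
Hypothesis A_trans : forall i j k, 0 < A i j -> 0 < A j k -> 0 < A i k.

Lemma walks_neq0 s i j n : walks s i j n != 0 -> 0 < A i j.
Proof.
elim: n i => [|n IH] i; first by rewrite walks0 eqxx.
rewrite walksS lt_def A_ge0 andbT => nz; apply/negP => /eqP Aij.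
move: nz; rewrite Aij mul0r add0r big1_seq ?eqxx// => x _.
apply/eqP; rewrite -[_ == _]negbK mulf_eq0 negb_or;
  apply/negP => /andP[ix /IH xj].
have : 0 < A i j by apply: A_trans xj; rewrite lt_def ix A_ge0.
by rewrite Aij ltxx.
Qed.

(** Transitivity supplies the hypothesis [0 < g 1] of [tame_star]: if some closed walk at [x] has
    nonzero weight, then the entry [A x x] is positive. Otherwise [star] reduces to its value at
    0. *)
Lemma tame_walks s i j : tame (walks s i j).
Proof.
elim: s i j => [|x s IH] i j.
  by left; exists 2%N => -[|[|n]]//= _; rewrite mulr0.
rewrite walks_cons; apply: tameD => //; apply: tame_conv => // [n|n|].
- exact: walks_ge0.
- by apply: conv_ge0 => m; rewrite ?star_ge0 ?walks_ge0// => k;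
  exact: walks_ge0.
apply: tame_conv => // [n|n|]; [apply: star_ge0 => k| |]; try exact: walks_ge0.
have [[n nz]|z] := pselect (exists n, walks s x x n != 0).
  apply: tame_star => // [k||]; [exact: walks_ge0|exact: walks0|].
  by rewrite walks1; exact: walks_neq0 nz.
left; exists 1%N => -[//|n] _; rewrite starE ?walks0//= /delta0 add0r /conv.
rewrite big1// => k _; apply/eqP; rewrite mulf_eq0; apply/orP; left.
by apply/negPn/negP => kz; apply: z; exists k.
Qed.

Lemma tame_mpow i j : tame (fun n => mpow n i j).
Proof.
apply: (tame_eq (N := 1%N)) (tame_walks (enum I) i j) => -[//|n] _.
exact: walks_mpow.
Qed.

End Transitive.

(** The pattern of positive entries of a power takes finitely many values and determines the later
    patterns, so it becomes periodic. If [p] is a multiple of the period beyond the preperiod, the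
    powers [p] and [p + p] have the same pattern, which is therefore transitive. *)
Lemma mpow_trans_exists : exists2 p, (0 < p)%N &
  forall i j k, 0 < mpow p i j -> 0 < mpow p j k -> 0 < mpow p i k.
Proof.
pose pat n : {ffun I * I -> bool} := [ffun ij => 0 < mpow n ij.1 ij.2].
have patD m m' n : pat m = pat m' -> pat (m + n)%N = pat (m' + n)%N.
  move=> E; have E' i j : (0 < mpow m i j) = (0 < mpow m' i j).
    by have /ffunP/(_ (i, j)) := E; rewrite !ffunE.
  apply/ffunP => -[i j]; rewrite !ffunE/=;
    apply/idP/idP => /mpow_gt0P[k [ik kj]].
    by apply: mpow_gt0D kj; rewrite -E'.
  by apply: mpow_gt0D kj; rewrite E'.
have [a [q [a0 q0 aq]]] : exists a q, [/\ (0 < a)%N,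
  (0 < q)%N & pat (a + q)%N = pat a].
  pose f (i : 'I_#|{ffun I * I -> bool}|.+1) := pat i.+1.
  have /injectivePn[x [y xy fxy]] : ~~ injectiveb f.
    apply/negP => /injectiveP/leq_card; rewrite card_ord ltnn//.
  wlog lt : x y xy fxy / (x < y)%N.
    move=> W; have [lt|lt|/val_inj E] := ltngtP x y; first exact: W lt.
    - by apply: (W y x) => //; rewrite eq_sym.
    - by rewrite E eqxx in xy.
  exists x.+1, (y - x)%N; split=> //; first by rewrite subn_gt0.
  by rewrite addSn subnKC ?(ltnW lt)// -[LHS]/(f y) -fxy.
have per n : (a <= n)%N -> pat (n + q)%N = pat n.
  by move=> an; rewrite -(subnKC an) addnAC; exact: patD.
have perk k n : (a <= n)%N -> pat (n + k * q)%N = pat n.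
  move=> an; elim: k => [|k IH]; first by rewrite addn0.
  by rewrite mulSn addnCA addnC per ?IH// (leq_trans an)// leq_addr.
exists (a * q)%N; first by rewrite muln_gt0 a0.
move=> i j k ij jk; have := perk a (a * q)%N; rewrite leq_pmulr// => /(_ isT).
by move=> /ffunP/(_ (i, k)); rewrite !ffunE/= => <-; exact: mpow_gt0D jk.
Qed.

End Paths.

Lemma mpowM (R : realType) (I : finType) (A : I -> I -> R) p n i j :
  mpow (mpow A p) n i j = mpow A (p * n) i j.
Proof.
elim: n i => [|n IH] i; first by rewrite muln0.
rewrite mulnS mpowD/=; by apply: eq_bigr => k _; rewrite IH.
Qed.

(** The subsequence of step [p] is a nonnegative combination, with coefficients [z s], of entries of
    the iterates of [mpow A p], a matrix whose positive entries form a transitive relation. *)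
Lemma tame_linear_system (R : realType) (I : finType) (A : I -> I -> R)
    (z : nat -> I -> R) :
  (forall i j, 0 <= A i j) -> (forall n i, 0 <= z n i) ->
  (forall n j, z n.+1 j = \sum_i z n i * A i j) ->
  exists2 p, (0 < p)%N & forall s j, tame (fun m => z (p * m + s)%N j).
Proof.
move=> A0 z0 zS; have [p p0 tr] := mpow_trans_exists A0.
exists p => // s j.
have zD n : z (n + s)%N j = \sum_i z s i * mpow A n i j.
  elim: n s => [|n IH] s.
    rewrite (bigD1 j)//= eqxx mulr1 big1 ?addr0// => k /negbTE ->.
    by rewrite mulr0.
  rewrite addSnnS IH/=; under eq_bigr do rewrite zS mulr_suml.
  rewrite exchange_big; apply: eq_bigr => i _ /=; rewrite mulr_sumr.
  by apply: eq_bigr => k _; rewrite mulrA.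
have T : tame (fun m => \sum_i z s i * mpow (mpow A p) m i j).
  apply: tame_sum => i; apply: tameZ => //.
  by apply: tame_mpow => // k l; exact: mpow_ge0.
apply: (tame_eq (N := 0%N)) T => m _; rewrite zD.
by apply: eq_bigr => i _; rewrite mpowM.
Qed.

(** * Accumulation points along residue classes *)

Lemma opposite_poly_coef (R : realType) (a : nat -> R) n k :
  (opposite_poly a n)`_k = if (k <= n)%N then a (n - k)%N / a n else 0.
Proof. by rewrite coef_poly ltnS. Qed.

(** A point [y] other than the [P] limits differs from each of them in some coordinate; a
    neighbourhood of [y] that restricts these finitely many coordinates misses [X n] for all large
    [n]. *)
Lemma finite_cluster_mod (R : realType) (X : nat -> {ptws nat -> R}) P
    (l : 'I_P -> nat -> R) : (0 < P)%N ->
  (forall (r : 'I_P) k, X (P * m + r)%N k @[m --> \oo] --> l r k) ->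
  finite_set (cluster (X @ \oo)).
Proof.
move=> P0 Xl; apply: (@sub_finite_set _ _ (l @` setT));
  last exact/finite_image/finite_finset.
move=> y yc /=; apply: contrapT => yl.
have nel r : {k | y k != l r k}.
  apply: cid; apply: contrapT => H; apply: yl; exists r => //.
  by apply/funext => k; apply: contrapT => yk; apply: H; exists k;
    apply/eqP => E; apply: yk.
pose k r := projT1 (nel r).
pose eps r := `|y (k r) - l r (k r)| / 2.
have eps0 r : 0 < eps r.
  by rewrite divr_gt0// normr_gt0 subr_eq0; exact: projT2 (nel r).
have /choice[N HN] (r : 'I_P) : exists N, forall m, (N <= m)%N ->
    `|X (P * m + r)%N (k r) - l r (k r)| <= eps r.
  exact: (cvgn_distP _ _).1 (Xl r (k r)) _ (eps0 r).
(* Beyond [M], the quotient of [n] by [P] is at least every [N r]. *)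
pose M := (P * \sum_(r < P) N r)%N.
have nbhsW : nbhs (y : {ptws nat -> R})
  (fun z : {ptws nat -> R} => forall r : 'I_P, `|y (k r) - z (k r)| < eps r).
  have Fy : Filter (nbhs (y : {ptws nat -> R})) by exact: nbhs_filter.
  apply: (@filter_forall _ _ (fun (r : 'I_P) (z : {ptws nat -> R}) => `|y (k r)
    - z (k r)| < eps r) _ Fy) => r.
  have := @proj_continuous nat (fun=> R) (k r) y.
  by move=> /cvgrPdist_lt/(_ _ (eps0 r)).
have [|z [[n Mn <-] Wz]] := yc [set X n | n in [set n | (M <= n)%N]] _ _ nbhsW.
  by exists M => // n /= Mn; exists n.
have rP : (n %% P < P)%N by rewrite ltn_mod.
pose r := Ordinal rP.
have := Wz r; have := HN r (n %/ P)%N.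
rewrite mulnC -divn_eq => H1 H2.
have : `|y (k r) - l r (k r)| < eps r + eps r.
  have -> : y (k r) - l r (k r) = (y (k r) - X n (k r)) +
    (X n (k r) - l r (k r)) by ring.
  apply: le_lt_trans (ler_normD _ _) _; apply: ltr_leD => //; apply: H1.
  rewrite leq_divRL// mulnC; apply: leq_trans Mn; rewrite leq_mul2l.
  by rewrite (bigD1 r)//= leq_addr orbT.
by rewrite /eps -splitr ltxx.
Qed.

(** Along a residue class, each coefficient of the opposite polynomials is eventually a ratio of two
    tame sequences; monotonicity of [a] provides the comparison required by [tame_ratio_cvg]. *)
Lemma finite_opposite_series (R : realType) (a : nat -> R) P D : (0 < P)%N ->
  (forall n, 0 <= a n) -> (forall n, a n <= a n.+1) ->
  (forall s, tame (fun m => a (P * m + s + D)%N)) ->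
  finite_set (opposite_series a).
Proof.
move=> P0 a0 aS ta.
have amono : {homo a : m n / (m <= n)%N >-> m <= n} by apply/nondecreasing_seqP.
have H (r : 'I_P) k : {l : R |
    poly_series (opposite_poly a (P * m + r)) k @[m --> \oo] --> l}.
  (* Starting [t] steps later keeps the natural number subtractions below from being truncated. *)
  apply: cid; pose t := (k + D)%N.
  have t1 : (k + D <= P * t)%N by rewrite leq_pmull.
  have [|l Hl] := tame_ratio_cvg (ta (P * t + r - k - D)%N)
    (ta (P * t + r - D)%N).
    by move=> m; rewrite a0/=; apply: amono; lia.
  exists l; apply/cvgn_distP => eps /((cvgn_distP _ _).1 Hl)[N HN].
  exists (N + t)%N => n nN; have := HN (n - t)%N.
  rewrite /poly_series opposite_poly_coef.
  have tn : (P * t <= P * n)%N by rewrite leq_mul2l; lia.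
  have -> : (k <= P * n + r)%N by lia.
  have -> : (P * (n - t) + (P * t + r - k - D) + D = P * n + r - k)%N.
    by rewrite mulnBr; lia.
  have -> : (P * (n - t) + (P * t + r - D) + D = P * n + r)%N.
    by rewrite mulnBr; lia.
  by apply; lia.
apply: (@finite_cluster_mod _ _ P (fun r k => sval (H r k))) => // r k.
exact: svalP (H r k).
Qed.

(** * The graph distance *)

Definition walk_of_size (V : eqType) (e : rel V) (u v : V) (n : nat) : bool :=
  `[< exists w : seq V, [/\ path e u w, last u w = v & size w = n] >].

(* 0 if there is no path. *)
Definition dist (V : eqType) (e : rel V) (u v : V) : nat :=
  if pselect (exists n, walk_of_size e u v n) is left h then ex_minn h else 0%N.

Section Dist.
Variables (V : eqType) (e : rel V).
Hypotheses (e_sym : symmetric e) (e_conn : connected_graph e).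

Local Notation d := (dist e).

Lemma dist_path u v : exists w, [/\ path e u w, last u w = v & size w = d u v].
Proof.
rewrite /dist; case: pselect => [h|[]].
  by case: ex_minnP => m /asboolP.
by have [w uw wv] := e_conn u v; exists (size w); apply/asboolP; exists w.
Qed.

Lemma dist_le_size u w : path e u w -> (d u (last u w) <= size w)%N.
Proof.
move=> uw; rewrite /dist; case: pselect => [h|//].
by case: ex_minnP => m _; apply; apply/asboolP; exists w.
Qed.

Lemma dist_refl u : d u u = 0%N.
Proof. by apply/eqP; rewrite -leqn0; exact: (@dist_le_size u [::]). Qed.

Lemma dist_triangle u v w : (d u w <= d u v + d v w)%N.
Proof.
have [s [us sv <-]] := dist_path u v; have [t [vt tw <-]] := dist_path v w.
rewrite -size_cat -tw -sv -last_cat; apply: dist_le_size.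
by rewrite cat_path us sv.
Qed.

Lemma dist_edge u v : e u v -> (d u v <= 1)%N.
Proof. by move=> uv; apply: (@dist_le_size u [:: v]); rewrite /= uv. Qed.

Lemma dist_sym_le u v : (d u v <= d v u)%N.
Proof.
have [s [vs sv <-]] := dist_path v u.
have : path e u (rev (belast v s)).
  rewrite -sv rev_path; apply: sub_path vs => a b /=; by rewrite e_sym.
move=> /dist_le_size; rewrite size_rev size_belast; congr (_ <= _)%N.
by congr d; case: s {vs} sv => [<-//|a s] _ /=; rewrite rev_cons last_rcons.
Qed.

Lemma dist_sym u v : d u v = d v u.
Proof. by apply/eqP; rewrite eqn_leq !dist_sym_le. Qed.

Lemma dist0_eq u v : d u v = 0%N -> u = v.
Proof. by have [[|a w] [_ <- <-]] := dist_path u v. Qed.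

Lemma graph_ballE x n v : graph_ball e x n v <-> (d x v <= n)%N.
Proof.
split=> [[w [xw <- wn]]|dn]; first exact: leq_trans (dist_le_size xw) wn.
by have [w [xw wv sw]] := dist_path x v; exists w; rewrite sw.
Qed.

Definition geodesic (c : nat -> V) (u v : V) : Prop :=
  [/\ c 0%N = u, c (d u v) = v & forall i, (i < d u v)%N -> e (c i) (c i.+1)].

Lemma geodesic_exists u v : exists c, geodesic c u v.
Proof.
have [w [uw wv sw]] := dist_path u v; exists (nth u (u :: w)).
split=> // [|i]; first by rewrite -sw -wv (last_nth u).
by rewrite -sw => iw; exact: (pathP u uw).
Qed.

Lemma walk_dist (c : nat -> V) i j : (i <= j)%N ->
  (forall k, (i <= k < j)%N -> e (c k) (c k.+1)) -> (d (c i) (c j) <= j - i)%N.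
Proof.
move=> ij H; have [k jk] : exists k, (j = i + k)%N by exists (j - i)%N; lia.
subst j; rewrite addKn; elim: k ij H => [|k IH] _ H;
  first by rewrite addn0 dist_refl.
apply: leq_trans (dist_triangle _ (c (i + k)%N) _) _;
  rewrite -[k.+1]addn1 leq_add//.
  by apply: IH; [lia|move=> l lk; apply: H; lia].
by rewrite addn1 addnS dist_edge// H//; lia.
Qed.

Lemma geodesic_dist c u v i : geodesic c u v -> (i <= d u v)%N ->
  d u (c i) = i /\ d (c i) v = (d u v - i)%N.
Proof.
move=> [c0 cl ce] il.
have H1 : (d u (c i) <= i)%N.
  by rewrite -{1}c0 -[leqRHS]subn0; apply: walk_dist => // k ki; apply: ce; lia.
have H2 : (d (c i) v <= d u v - i)%N.
  by rewrite -{1}cl; apply: walk_dist => // k ki; apply: ce; lia.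
by have := dist_triangle u (c i) v; split; lia.
Qed.

Lemma geodesic_through u p v : (d u p + d p v = d u v)%N ->
  exists2 c, geodesic c u v & c (d u p) = p.
Proof.
move=> upv; have [c1 [c10 c1l c1e]] := geodesic_exists u p.
have [c2 [c20 c2l c2e]] := geodesic_exists p v.
exists (fun i => if (i <= d u p)%N then c1 i else c2 (i - d u p)%N);
  last by rewrite leqnn.
split=> [//||i il].
  rewrite -upv; case: ifP => h; last by rewrite addKn.
  have pv : d p v = 0%N by lia.
  by rewrite pv addn0 c1l -c2l pv c20.
have [lt|gt|E] := ltngtP i (d u p).
- exact: c1e.
- by rewrite subSn ?(ltnW gt)//; apply: c2e; lia.
- by rewrite E c1l subSnn -[X in e X]c20; apply: c2e; lia.
Qed.

End Dist.

(** * Geodesics of the metric graph *)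

Section Realization.
Variables (R : realType) (V : eqType) (e : rel V).
Hypotheses (e_sym : symmetric e) (e_conn : connected_graph e).

Local Notation d := (dist e).
Local Notation point := (V -> R).

Lemma edge_point0 (u v w : V) : edge_point u v 0 = edge_point u w 0 :> point.
Proof. by apply/funext => z; rewrite /edge_point !mul0r. Qed.

Lemma edge_point1 (u v w : V) : edge_point u v 1 = edge_point v w 0 :> point.
Proof. by apply/funext => z; rewrite /edge_point; ring. Qed.

Lemma vertex_pointE (u v : V) : vertex_point R u = edge_point u v 0.
Proof. by apply/funext => z; rewrite /edge_point /vertex_point; ring. Qed.

Lemma pl_path_cat (p q r : point) l m :
  pl_path e p q l -> pl_path e q r m -> pl_path e p r (l + m).
Proof.
move=> pq; elim: pq => [{}p|u v a b {}q {}l uv a01 b01 _ IH] qr;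
  first by rewrite add0r.
by rewrite -addrA; apply: pl_cons => //; exact: IH.
Qed.

Lemma pl_path_edge (u v : V) (a b : R) : e u v -> 0 <= a <= 1 -> 0 <= b <= 1 ->
  pl_path e (edge_point u v a) (edge_point u v b) `|a - b|.
Proof.
by move=> uv a01 b01; rewrite -(addr0 `|a - b|); apply: pl_cons => //;
  exact: pl_nil.
Qed.

Lemma pl_path_sym (p q : point) l : pl_path e p q l -> pl_path e q p l.
Proof.
elim=> [{}p|u v a b {}q {}l uv a01 b01 _ IH]; first exact: pl_nil.
by rewrite addrC distrC; apply: pl_path_cat IH _; exact: pl_path_edge.
Qed.

Lemma pl_path_ge0 (p q : point) l : pl_path e p q l -> 0 <= l.
Proof. by elim=> // u v a b {}q {}l _ _ _ _ IH; rewrite addr_ge0. Qed.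

Lemma path_metric_le (p q : point) l : pl_path e p q l ->
  path_metric e p q <= l.
Proof.
by move=> pq; apply: ge_inf => //; exists 0 => m; exact: pl_path_ge0.
Qed.

(* The distance to [z], extended linearly to the edges; it is 1-Lipschitz. *)
Definition height (z u v : V) (t : R) : R :=
  (1 - t) * (d z u)%:R + t * (d z v)%:R.

(** A point may lie on several edges; [height] is well defined because it is the sum of the
    distances to [z] weighted by the barycentric coordinates. *)
Lemma height_eq (z u v u' v' : V) (t t' : R) :
  edge_point u v t = edge_point u' v' t' :> point ->
    height z u v t = height z u' v' t'.
Proof.
move=> E; pose s := undup [:: u; v; u'; v'].
have us : uniq s by exact: undup_uniq.
have H (a b : V) (r : R) : a \in s -> b \in s ->
    height z a b r = \sum_(w <- s) edge_point a b r w * (d z w)%:R.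
  move=> sa sb; under eq_bigr do rewrite /edge_point mulrDl.
  rewrite big_split/= (bigD1_seq a)//= eqxx big1 ?addr0; last first.
    by move=> i /negbTE ->; rewrite mulr0 mul0r.
  rewrite (bigD1_seq b)//= eqxx big1 ?addr0; first by rewrite !mulr1.
  by move=> i /negbTE ->; rewrite mulr0 mul0r.
rewrite !H ?mem_undup ?inE ?eqxx ?orbT//.
by rewrite E.
Qed.

Lemma pl_path_height (z u v u' v' : V) (t t' l : R) :
  pl_path e (edge_point u v t) (edge_point u' v' t') l ->
  `|height z u v t - height z u' v' t'| <= l.
Proof.
move Ep : (edge_point u v t) => p; move Eq : (edge_point u' v' t') => q pq.
elim: pq u v t Ep Eq => [{}p|a b r r' {}q {}l ab _ _ _ IH] u v t Ep Eq.
  by rewrite (@height_eq z u v u' v' t t') ?subrr ?normr0// Ep.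
rewrite (height_eq z Ep).
have -> : height z a b r - height z u' v' t' =
  (height z a b r - height z a b r') + (height z a b r' - height z u' v' t') by
    ring.
apply: le_trans (ler_normD _ _) _; rewrite lerD ?IH//.
have -> : height z a b r - height z a b r' = (r - r') *
  ((d z b)%:R - (d z a)%:R).
  by rewrite /height; ring.
rewrite normrM ler_piMr// ler_norml.
have := dist_triangle e_conn z a b; have := dist_triangle e_conn z b a.
have := dist_edge ab; have := dist_edge (etrans (e_sym b a) ab).
move=> h1 h2 h3 h4.
have hb : (d z b)%:R <= (d z a)%:R + 1 :> R by rewrite natr1 ler_nat; lia.
have ha : (d z a)%:R <= (d z b)%:R + 1 :> R by rewrite natr1 ler_nat; lia.
by apply/andP; split; lra.
Qed.

(** The existence of a path excludes the infimum of the empty set, which is a default value. *)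
Lemma path_metric_ge (z u v u' v' : V) (t t' : R) :
  (exists l, pl_path e (edge_point u v t) (edge_point u' v' t') l) ->
  `|height z u v t - height z u' v' t'| <=
  path_metric e (edge_point u v t) (edge_point u' v' t').
Proof.
move=> [l h]; apply: lb_le_inf; first by exists l.
by move=> m; exact: pl_path_height.
Qed.

Definition param (c : nat -> V) (s : R) : point :=
  edge_point (c (Num.trunc s)) (c (Num.trunc s).+1) (s - (Num.trunc s)%:R).

Lemma paramE (c : nat -> V) (s : R) i : i%:R <= s <= i.+1%:R ->
  param c s = edge_point (c i) (c i.+1) (s - i%:R).
Proof.
move=> /andP[i_s s_i]; rewrite /param.
have [lt|ge] := ltP s i.+1%:R.
  by have -> : Num.trunc s = i by apply: truncn_def; rewrite i_s lt.
have -> : s = i.+1%:R by apply/le_anti; rewrite s_i ge.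
rewrite natrK subrr -natr1 addrAC subrr add0r.
by rewrite (edge_point1 _ _ (c i.+2)).
Qed.

Lemma pl_path_param (c : nat -> V) l (s t : R) :
  (forall i, (i < l)%N -> e (c i) (c i.+1)) -> 0 <= s -> s <= t -> t <= l%:R ->
  pl_path e (param c s) (param c t) (t - s).
Proof.
move=> ce s0 st tl; have t0 := le_trans s0 st.
have [n Hn] : exists n, t <= (Num.trunc s + n)%:R.
  by exists l; apply: le_trans tl _; rewrite ler_nat leq_addl.
elim: n s s0 st Hn => [|n IH] s s0 st Hn.
  have ts : t = s.
    apply/le_anti; rewrite st andbT; apply: le_trans Hn _; rewrite addn0.
    by rewrite truncn_le.
  by rewrite ts subrr; exact: pl_nil.
have /andP[is_ si] := truncn_itv s0; set i := Num.trunc s in is_ si Hn.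
have [->|tns] := eqVneq t s; first by rewrite subrr; exact: pl_nil.
have s_t : s < t by rewrite lt_neqAle eq_sym tns.
have il : (i < l)%N by rewrite -(ltr_nat R); lra.
have [ti|ti] := leP t i.+1%:R.
  have -> : t - s = `|(s - i%:R) - (t - i%:R)| by rewrite ler0_norm; lra.
  rewrite (@paramE c s i) ?is_ ?(ltW si)// (@paramE c t i);
    last by rewrite ti andbT; lra.
  by apply: pl_path_edge; [exact: ce| |]; move: ti si; rewrite -!natr1; lra.
have -> : t - s = (i.+1%:R - s) + (t - i.+1%:R) by ring.
apply: (@pl_path_cat _ (param c i.+1%:R)).
  have -> : i.+1%:R - s = `|(s - i%:R) - (i.+1%:R - i%:R)| by rewrite
    ler0_norm; lra.
  rewrite (@paramE c s i) ?is_ ?(ltW si)// (@paramE c i.+1%:R i);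
    last by rewrite lexx andbT ler_nat.
  by apply: pl_path_edge; [exact: ce| |]; move: ti si; rewrite -!natr1; lra.
by apply: IH; rewrite ?ler0n ?(ltW ti)// natrK addSnnS.
Qed.

Lemma geodesic_segment_param (c : nat -> V) (u v : V) : geodesic e c u v ->
  geodesic_segment e (vertex_point R u) (vertex_point R v)
    (param c @` [set s | 0 <= s <= (d u v)%:R]).
Proof.
move=> cg; have [c0 cl ce] := cg; exists (d u v)%:R, (param c); split=> //.
- move=> s /andP[s0 sl]; have /andP[is_ si] := truncn_itv s0.
  set i := Num.trunc s in is_ si.
  have [lt|ge] := ltnP i (d u v).
    right; exists (c i), (c i.+1), (s - i%:R); split=> //; first exact: ce.
    by move: si; rewrite -natr1; lra.
  left; exists (c i); rewrite /param -/i.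
  have -> : s = i%:R.
    by apply/le_anti; rewrite is_ andbT (le_trans sl)// ler_nat.
  by rewrite subrr -vertex_pointE.
- move=> s t /andP[s0 sl] /andP[t0 tl].
  wlog st : s t s0 sl t0 tl / s <= t.
    move=> W; have [st|/ltW ts] := leP s t; first exact: W.
    rewrite distrC -W//; congr inf; apply/seteqP.
    by split=> l; exact: pl_path_sym.
  have P := pl_path_param ce s0 st tl.
  rewrite distrC ger0_norm ?subr_ge0//; apply/le_anti/andP; split.
    exact: path_metric_le.
  (* Along the geodesic the height above [u] equals the parameter, so the Lipschitz property gives
     the lower bound on the metric. *)
  have hE r : 0 <= r -> r <= (d u v)%:R ->
      height u (c (Num.trunc r)) (c (Num.trunc r).+1) (r - (Num.trunc r)%:R) =
        r.
    move=> r0 rl; have /andP[ir ri] := truncn_itv r0; rewrite /height.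
    set i := Num.trunc r in ir ri *.
    have il : (i <= d u v)%N by rewrite -(ler_nat R) (le_trans ir).
    rewrite (geodesic_dist e_conn cg il).1.
    have [lt|ge] := ltnP i (d u v).
      by rewrite (geodesic_dist e_conn cg lt).1 -natr1; ring.
    have -> : r = i%:R.
      by apply/le_anti; rewrite ir andbT (le_trans rl)// ler_nat.
    ring.
  have := @path_metric_ge u (c (Num.trunc s)) (c (Num.trunc s).+1)
    (c (Num.trunc t))
    (c (Num.trunc t).+1) (s - (Num.trunc s)%:R) (t - (Num.trunc t)%:R).
  rewrite !hE// distrC ger0_norm ?subr_ge0//; apply; by exists (t - s).
- by split; [rewrite (@paramE c 0 0) ?lexx ?ler01// subrr -vertex_pointE c0
            |rewrite /param natrK subrr -vertex_pointE cl].
Qed.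

(** The distance to [p] is extended affinely to the edge containing [param c s], so it is not larger
    at one of the two ends: the point of the geodesic may be replaced by a vertex, with the same
    [delta]. *)
Lemma near_param (c : nat -> V) (u v p : V) (s : R) (delta : R) :
  geodesic e c u v ->
  0 <= s <= (d u v)%:R -> path_metric e (vertex_point R p) (param c s) <= delta
    ->
  exists q, (d p q)%:R <= delta /\ (d u q + d q v = d u v)%N.
Proof.
move=> cg /andP[s0 sl]; have [c0 cl ce] := cg.
have /andP[is_ si] := truncn_itv s0; rewrite /param; set i :=
  Num.trunc s in is_ si *.
have conn : exists l, pl_path e (edge_point p p 0)
  (edge_point (c i) (c i.+1) (s - i%:R)) l.
  have [c' [c'0 c'l c'e]] := geodesic_exists e_conn p u.
  have P1 := @pl_path_param c' _ 0 (d p u)%:R c'e (lexx _) (ler0n _ _) (lexx _).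
  have P2 := @pl_path_param c _ 0 s ce (lexx _) s0 sl.
  exists ((d p u)%:R - 0 + (s - 0)); apply: pl_path_cat P2.
  move: P1; rewrite [param c' (_)%:R]/param natrK subrr c'l.
  rewrite (@paramE c' 0 0) ?lexx ?ler01// (@paramE c 0 0) ?lexx ?ler01// subrr
    c'0 c0.
  by rewrite (edge_point0 p _ p) (edge_point0 u _ (c 1%N)).
have := path_metric_ge p conn; rewrite (vertex_pointE p p).
move=> /le_trans h /h; rewrite /height !(dist_refl e p) !mulr0 addr0 sub0r
  normrN.
set t := s - i%:R => {}h.
have t01 : 0 <= t < 1 by rewrite /t; move: si; rewrite -natr1; lra.
have il : (i <= d u v)%N by rewrite -(ler_nat R) (le_trans is_).
have on j : (j <= d u v)%N -> (d u (c j) + d (c j) v = d u v)%N.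
  by move=> jl; have [-> ->] := geodesic_dist e_conn cg jl; rewrite subnKC.
have [lt|ge] := ltnP i (d u v); last first.
  exists (c i); split; last exact: on.
  have t0 : t = 0.
    rewrite /t; apply/eqP; rewrite subr_eq0; apply/eqP/le_anti.
    by rewrite is_ andbT (le_trans sl)// ler_nat.
  by move: h; rewrite t0 subr0 mul1r mul0r addr0 ger0_norm.
have [dd|dd] := leqP (d p (c i)) (d p (c i.+1)).
  exists (c i); split; last exact: on.
  apply: le_trans h; rewrite ger0_norm; last by rewrite addr_ge0// mulr_ge0//;
    lra.
  by move: dd; rewrite -(ler_nat R); nra.
exists (c i.+1); split; last exact: on.
apply: le_trans h; rewrite ger0_norm; last by rewrite addr_ge0// mulr_ge0//;
  lra.
by move: dd => /ltnW; rewrite -(ler_nat R); nra.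
Qed.

(** The form of hyperbolicity used for counting. Lying on some geodesic is equality in the triangle
    inequality, and [delta] may be truncated because distances between vertices are integers. *)
Lemma thin_triangles (delta : R) : 0 <= delta -> delta_hyperbolic e delta ->
  forall a b z p, (d a p + d p b = d a b)%N ->
  exists q, (d p q <= Num.trunc delta)%N /\
    ((d b q + d q z = d b z)%N \/ (d z q + d q a = d z a)%N).
Proof.
move=> delta0 hyp a b z p apb.
have [c1 g1 c1p] := geodesic_through e_conn apb.
have [c2 g2] := geodesic_exists e_conn b z.
have [c3 g3] := geodesic_exists e_conn z a.
have [H _ _] := hyp _ _ _ _ _ _ (geodesic_segment_param g1)
  (geodesic_segment_param g2) (geodesic_segment_param g3).
have : (param c1 @` [set s | 0 <= s <= (d a b)%:R]) (vertex_point R p).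
  exists (d a p)%:R; first by rewrite /= ler0n ler_nat -apb leq_addr.
  by rewrite /param natrK subrr c1p -vertex_pointE.
have dn q : (d p q)%:R <= delta -> (d p q <= Num.trunc delta)%N.
  by move=> pq; rewrite truncn_ge_nat.
move=> /H[q [] [s sl <-]].
  by move=> /(near_param g2 sl)[r [/dn pr br]]; exists r; split=> //; left.
by move=> /(near_param g3 sl)[r [/dn pr br]]; exists r; split=> //; right.
Qed.

End Realization.

(** * Cone types *)

Section ConeTypes.
Variables (V : choiceType) (e : rel V) (x : V) (delta D : nat).
Hypotheses (e_sym : symmetric e) (e_conn : connected_graph e).
Hypotheses (e_fin : finite_valence e) (e_trans : vertex_transitive e).
Hypothesis D_gt0 : (0 < D)%N.

Local Notation d := (dist e).
Local Notation h := (dist e x).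

Hypothesis thin : forall a b z p, (d a p + d p b = d a b)%N ->
  exists q, (d p q <= delta)%N /\
    ((d b q + d q z = d b z)%N \/ (d z q + d q a = d z a)%N).

Definition auto_pair (f g : V -> V) : Prop :=
  [/\ cancel f g, cancel g f & {mono f : u v / e u v}].

Lemma auto_pair_sym f g : auto_pair f g -> auto_pair g f.
Proof. by move=> [fg gf fe]; split=> // u v; rewrite -fe !gf. Qed.

Lemma auto_pair_comp f g f' g' : auto_pair f g -> auto_pair f' g' ->
  auto_pair (f' \o f) (g \o g').
Proof.
move=> [fg gf fe] [fg' gf' fe']; split; [exact: can_comp|exact: can_comp|].
by move=> u v /=; rewrite fe' fe.
Qed.

Lemma auto_dist_le f g u v : auto_pair f g -> (d (f u) (f v) <= d u v)%N.
Proof.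
move=> [_ _ fe]; have [w [uw <- <-]] := dist_path e_conn u v.
rewrite -last_map -(size_map f); apply: dist_le_size.
by rewrite path_map; apply: sub_path uw => a b /=; rewrite fe.
Qed.

Lemma auto_dist f g u v : auto_pair f g -> d (f u) (f v) = d u v.
Proof.
move=> fg; apply/eqP; rewrite eqn_leq (auto_dist_le _ _ fg)/=.
have := auto_dist_le (f u) (f v) (auto_pair_sym fg).
by case: fg => fK _ _; rewrite !fK.
Qed.

Lemma auto_pair_exists v : exists fg : (V -> V) * (V -> V),
  auto_pair fg.1 fg.2 /\ fg.1 x = v.
Proof.
have [f [[g fg gf] fe] fx] := e_trans x v.
by exists (f, g).
Qed.

(** The [D]-neighbourhood of the cone of [v]. The margin [D] makes room for predecessors and for
    embeddings of [Y] rooted at [v]. *)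
Definition near_cone (v w : V) : Prop :=
  exists u, (h v + d v u = h u)%N /\ (d u w <= D)%N.

(** The map [f] shifts heights by the constant [h v' - h v]; the additive form avoids truncated
    subtraction. *)
Definition matches (f : V -> V) (v v' : V) : Prop :=
  forall w, near_cone v w -> (h (f w) + h v = h w + h v')%N.

(** With both directions, [f] maps the near cone of [v] onto that of [v'], and the relation is
    symmetric. *)
Definition same_cone_type (v v' : V) : Prop :=
  exists f g, [/\ auto_pair f g, f v = v', matches f v v' & matches g v' v].

Lemma near_cone_near v w : (d v w <= D)%N -> near_cone v w.
Proof. by exists v; rewrite dist_refl addn0. Qed.

Lemma near_cone_cone v u : (h v + d v u = h u)%N -> near_cone v u.
Proof. by exists u; rewrite dist_refl. Qed.

Lemma near_cone_trans v u w : (h v + d v u = h u)%N -> near_cone u w ->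
  near_cone v w.
Proof.
move=> vu [t [ut tw]]; exists t; split=> //.
have := dist_triangle e_conn v u t; have := dist_triangle e_conn x v t; lia.
Qed.

Lemma matches_cone f g v v' u : auto_pair f g -> f v = v' -> matches f v v' ->
  (h v + d v u = h u)%N -> (h v' + d v' (f u) = h (f u))%N /\ matches f u (f u).
Proof.
move=> fg fv m vu; have mu := m u (near_cone_cone vu).
have E : (h v' + d v' (f u) = h (f u))%N by rewrite -{2}fv (auto_dist _ _ fg);
  lia.
split=> // w /(near_cone_trans vu)/m; lia.
Qed.

Lemma same_cone_type_refl v : same_cone_type v v.
Proof. by exists id, id; split=> // w _. Qed.

Lemma same_cone_type_sym v v' : same_cone_type v v' -> same_cone_type v' v.
Proof.
move=> [f [g [fg fv m m']]]; exists g, f; split=> //;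
  first exact: auto_pair_sym.
by rewrite -fv; case: fg => ->.
Qed.

Lemma matches_comp f g f' v v' v'' : auto_pair f g -> f v = v' ->
  matches f v v' ->
  matches f' v' v'' -> matches (f' \o f) v v''.
Proof.
move=> fg fv m m' w vw /=.
have vw' : near_cone v' (f w).
  have [u [vu uw]] := vw; exists (f u).
  by rewrite (matches_cone fg fv m vu).1 (auto_dist _ _ fg).
by have := m _ vw; have := m' _ vw'; lia.
Qed.

Lemma same_cone_type_trans v v' v'' :
  same_cone_type v v' -> same_cone_type v' v'' -> same_cone_type v v''.
Proof.
move=> [f [g [fg fv m n]]] [f' [g' [fg' fv' m' n']]].
have gv : g v' = v by rewrite -fv; case: fg => ->.
have gv' : g' v'' = v' by rewrite -fv'; case: fg' => ->.
exists (f' \o f), (g \o g'); split.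
- exact: auto_pair_comp.
- by rewrite /= fv.
- exact: matches_comp fg fv m m'.
- exact: matches_comp (auto_pair_sym fg') gv' n' n.
Qed.

Lemma same_cone_type_succ v v' f g u : auto_pair f g -> f v = v' ->
  matches f v v' -> matches g v' v -> (h v + d v u = h u)%N ->
  same_cone_type u (f u).
Proof.
move=> fg fv m m' vu; have [vu' mu] := matches_cone fg fv m vu.
have gv : g v' = v by rewrite -fv; case: fg => ->.
have [_ mu'] := matches_cone (auto_pair_sym fg) gv m' vu'.
have gfu : g (f u) = u by case: fg => ->.
by exists f, g; split=> //; rewrite gfu in mu'.
Qed.

Section LocalToGlobal.
Variables (f g : V -> V) (v v' : V).
Hypotheses (fg : auto_pair f g) (fv : f v = v').
Hypothesis local : forall w, (d v w <= 2 * D + delta)%N ->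
  (h (f w) + h v = h w + h v')%N.

(* A vertex [w] near a point [u] of the cone that is far from [v] has, by
   thinness, a geodesic to [x] that passes within [delta] of [v]; so [h w] is
   determined by the values of [h] near [v]. *)
Lemma matches_far u w : (h v + d v u = h u)%N ->
  (h v' + d v' (f u) = h (f u))%N ->
  (d u w <= D)%N -> (h (f w) + h v = h w + h v')%N.
Proof.
move=> vu vu' uw; have [|far] := leqP (d v w) (2 * D + delta)%N;
  first exact: local.
have fd a b : d (f a) (f b) = d a b by exact: (auto_dist _ _ fg).
have far_u : (D + delta < d v u)%N by have := dist_triangle e_conn v u w; lia.
(* In the triangle [x], [u], [w], a point within [delta] of [v] is too far from [u] to lie on a
   geodesic from [u] to [w]; so it lies on one from [w] to [x]. *)
have T1 : exists q, (d v q <= delta)%N /\ (h w = h q + d q w)%N.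
  have [q [vq [E|E]]] := thin w vu.
    have := dist_triangle e_conn v q u; rewrite (dist_sym e_sym e_conn q u);
      lia.
  exists q; split=> //; move: E.
  rewrite (dist_sym e_sym e_conn w q) (dist_sym e_sym e_conn q x)
    (dist_sym e_sym e_conn w x); lia.
have T2 : exists q, (d v q <= delta)%N /\ (h (f w) = h (f q) + d q w)%N.
  have [q [vq H]] := thin (f w) vu'.
  have qE : q = f (g q) by case: fg => _ ->.
  move: vq H; rewrite qE; move: (g q) => r; rewrite -fv !fd => vr H.
  exists r; split=> //; case: H => E.
    have := dist_triangle e_conn v r u; rewrite (dist_sym e_sym e_conn r u);
      lia.
  move: E; rewrite (dist_sym e_sym e_conn w r) (dist_sym e_sym e_conn _ x)
    (dist_sym e_sym e_conn _ x); lia.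
(* [q1] bounds [h (f w)] from above and [q2] bounds [h w] from above; since [h] is matched at both
   points, equality follows. *)
have [q1 [vq1 E1]] := T1; have [q2 [vq2 E2]] := T2.
have l1 : (h (f q1) + h v = h q1 + h v')%N by apply: local; lia.
have l2 : (h (f q2) + h v = h q2 + h v')%N by apply: local; lia.
have := dist_triangle e_conn x (f q1) (f w); rewrite fd.
have := dist_triangle e_conn x q2 w; lia.
Qed.

(** Induction along a geodesic from [v] to [u]: its penultimate vertex stays in the cone, and [u] is
    within [D] of it because [D] is positive, so [matches_far] gives the height of [f u]. *)
Lemma cone_preserved u : (h v + d v u = h u)%N ->
  (h v' + d v' (f u) = h (f u))%N.
Proof.
have [n] := ubnP (d v u); elim: n u => // n IH u un vu.
have fd a b : d (f a) (f b) = d a b by exact: (auto_dist _ _ fg).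
case E : (d v u) => [|l].
  by rewrite -(dist0_eq e_conn E) fv dist_refl addn0.
have [c cg] := geodesic_exists e_conn v u.
have ll : (l <= d v u)%N by rewrite E.
have [vc cu] := geodesic_dist e_conn cg ll.
have vcc : (h v + d v (c l) = h (c l))%N.
  have := dist_triangle e_conn x (c l) u; have :=
    dist_triangle e_conn x v (c l); lia.
have vcc' : (h v' + d v' (f (c l)) = h (f (c l)))%N by apply: IH => //; lia.
have := @matches_far (c l) u vcc vcc'.
rewrite cu E subSnn => /(_ D_gt0).
by rewrite -fv fd E; lia.
Qed.

Lemma local_matches : matches f v v'.
Proof. by move=> w [u [vu uw]]; apply: (matches_far vu) => //;
  exact: cone_preserved. Qed.

End LocalToGlobal.

Lemma local_same_cone_type f g v v' : auto_pair f g -> f v = v' ->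
  (forall w, (d v w <= 2 * D + delta)%N -> (h (f w) + h v = h w + h v')%N) ->
  same_cone_type v v'.
Proof.
move=> fg fv local; exists f, g; split=> //;
  first exact: local_matches fg fv local.
have gv : g v' = v by rewrite -fv; case: fg => ->.
apply: (local_matches (auto_pair_sym fg) gv) => w vw.
have wE : f (g w) = w by case: fg => _ ->.
have := local (g w); rewrite wE -(auto_dist v (g w) fg) wE fv => /(_ vw); lia.
Qed.

Lemma finite_ball n : finite_set [set v | (h v <= n)%N].
Proof.
elim: n => [|n IH].
  apply: (sub_finite_set _ (finite_set1 x)) => v /=;
    rewrite leqn0 => /eqP/(dist0_eq e_conn) <-//.
have F : finite_set (\bigcup_(u in [set v | (h v <= n)%N]) [set v | e u v]).
  by apply: bigcup_finite => // u _; exact: e_fin.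
have FU : finite_set ([set v | (h v <= n)%N] `|`
  \bigcup_(u in [set v | (h v <= n)%N]) [set v | e u v]).
  by rewrite finite_setU.
apply: (sub_finite_set _ FU) => v /=.
rewrite leq_eqVlt ltnS => /orP[/eqP vn|]; last by left.
have [c cg] := geodesic_exists e_conn x v; right; exists (c n) => /=.
  by have nl : (n <= h v)%N by [rewrite vn];
    rewrite (geodesic_dist e_conn cg nl).1.
by have [_ cl ce] := cg; rewrite -cl vn; apply: ce; rewrite vn.
Qed.

(** The heights relative to [v] on the ball of radius [N] about [v], read on the ball about [x]
    through a chosen automorphism, take finitely many values, and they determine the cone type by
    [local_same_cone_type]. *)
Lemma finite_cone_types : exists (T : finType) (st : V -> T),
  forall v v', st v = st v' <-> same_cone_type v v'.
Proof.
have /choice[F HF] := auto_pair_exists.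
pose N := (2 * D + delta)%N; pose B := fset_set [set v | (h v <= N)%N].
have inB b : (h b <= N)%N -> b \in B by move=> hb; rewrite in_fset_set;
  [exact: mem_set|exact: finite_ball].
(* The offset [N] makes the difference of heights a natural number, at most [2 * N]. *)
pose tau v : {ffun B -> 'I_(2 * N).+1} :=
  [ffun b : B => inord (h ((F v).1 (val b)) + N - h v)%N].
have close v b : (h b <= N)%N -> (h v <= h ((F v).1 b) + N)%N /\
  (h ((F v).1 b) <= h v + N)%N.
  move=> hb; have [fg fx] := HF v; have := auto_dist x b fg; rewrite fx => E.
  have := dist_triangle e_conn x v ((F v).1 b).
  have := dist_triangle e_conn x ((F v).1 b) v.
  rewrite (dist_sym e_sym e_conn ((F v).1 b) v); lia.
have tau_same v v' : tau v = tau v' -> same_cone_type v v'.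
  move=> E; have [fg fx] := HF v; have [fg' fx'] := HF v'.
  have gv : (F v).2 v = x by rewrite -{2}fx; case: fg => ->.
  apply: (local_same_cone_type (auto_pair_comp (auto_pair_sym fg) fg')).
    by rewrite /= gv fx'.
  move=> w vw /=; pose b := (F v).2 w.
  have hb : (h b <= N)%N.
    by rewrite -[x in dist _ x]gv /b (auto_dist _ _ (auto_pair_sym fg)).
  have fb : (F v).1 b = w by rewrite /b; case: fg => _ ->.
  have /ffunP/(_ [` inB b hb]%fset) := E; rewrite !ffunE/= => /(congr1 val)/=.
  have [c1 c2] := close v b hb; have [c3 c4] := close v' b hb.
  rewrite !inordK; [|lia|lia].
  rewrite -/b; move: c1 c2 c3 c4; rewrite fb; lia.
(* Different values of [tau] may belong to one cone type; the label of [v] is the set of values of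
   [tau] occurring in its class, so labels agree exactly for equal types. *)
exists {ffun {ffun B -> 'I_(2 * N).+1} -> bool}.
exists (fun v => [ffun t => `[< exists v',
  tau v' = t /\ same_cone_type v v' >]]).
move=> v v'; split=> [/ffunP/(_ (tau v'))|vv'].
  rewrite !ffunE => E; have : `[< exists w,
    tau w = tau v' /\ same_cone_type v w >].
    by rewrite E; apply/asboolP; exists v'; split=> //;
      exact: same_cone_type_refl.
  move=> /asboolP[w [/tau_same wv' vw]]; exact: same_cone_type_trans wv'.
apply/ffunP => t; rewrite !ffunE; apply/asboolP/asboolP => -[w [wt ww]];
  exists w; split=> //.
  exact: same_cone_type_trans (same_cone_type_sym vv') ww.
exact: same_cone_type_trans ww.
Qed.

End ConeTypes.

(** * Counting embeddings by cone types *)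

Lemma card_fset_set_le (T U : choiceType) (A : set T) (B : set U) (f : T -> U) :
  finite_set A -> finite_set B -> injective f -> (forall a, A a -> B (f a)) ->
  (#|` fset_set A| <= #|` fset_set B|)%N.
Proof.
move=> finA finB f_inj AB.
have <- : #|` [fset f a | a in fset_set A]%fset| = #|` fset_set A| by rewrite
  card_imfset.
apply: fsubset_leq_card; apply/fsubsetP => _ /imfsetP[a /= aA ->].
rewrite in_fset_set//; apply: mem_set; apply: AB.
by rewrite in_fset_set// in aA; exact: set_mem.
Qed.

Lemma card_fset_set_sum (T : choiceType) (A : set T) (S : {fset T})
  (Q : pred T) :
  (forall u, A u <-> u \in S /\ Q u) ->
    #|` fset_set A| = (\sum_(u <- S | Q u) 1)%N.
Proof.
move=> AQ; rewrite sum1_count -size_filter; apply: perm_size; apply: uniq_perm.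
- exact: fset_uniq.
- by rewrite filter_uniq// fset_uniq.
have finA : finite_set A.
  apply: (@sub_finite_set _ _ [set` S]); last exact: finite_fset.
  by move=> u /AQ[].
move=> u; rewrite in_fset_set// mem_filter;
  apply/idP/idP => [/set_mem/AQ[-> ->]//|].
by move=> /andP[Qu uS]; apply: mem_set; apply/AQ.
Qed.

Lemma finite_maps (Y : finType) (V : choiceType) (A : set V) : finite_set A ->
  finite_set [set f : {ffun Y -> V} | forall y, A (f y)].
Proof.
move=> finA; pose F (k : {ffun Y -> fset_set A}) : {ffun Y -> V} :=
  [ffun y => val (k y)].
apply: (@sub_finite_set _ _ (F @` setT)); last first.
  by apply: finite_image; exact: (@finite_finset {ffun Y -> fset_set A} setT).
move=> f fA; have fB y : f y \in fset_set A by rewrite in_fset_set//;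
  apply: mem_set; exact: fA.
exists [ffun y => [` fB y]%fset] => //.
by apply/ffunP => y; rewrite !ffunE.
Qed.

Section Counting.
Variables (V : choiceType) (e : rel V) (x : V) (delta D : nat).
Hypotheses (e_sym : symmetric e) (e_conn : connected_graph e).
Hypotheses (e_fin : finite_valence e) (D_gt0 : (0 < D)%N).

Local Notation d := (dist e).
Local Notation h := (dist e x).

Variables (T : finType) (st : V -> T).
Hypothesis stP : forall v v', st v = st v' <-> same_cone_type e x D v v'.

Let sphere n : {fset V} := fset_set [set v | h v = n].

Let finite_sphere n : finite_set [set v | h v = n].
Proof.
by apply: (sub_finite_set _ (finite_ball x e_conn e_fin n)) => v /= ->.
Qed.

Let in_sphere n v : (v \in sphere n) = (h v == n).
Proof.
rewrite in_fset_set//; apply/idP/eqP => [/set_mem//|hv]; exact: mem_set.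
Qed.

Let finite_level n (A : set V) : (forall v, A v -> h v = n) -> finite_set A.
Proof. by move=> AH; exact: (sub_finite_set AH (finite_sphere n)). Qed.

(** Vertices of equal type are related by matching automorphisms in both directions, so the two
    finite sets inject into each other. The action [act] covers both sets of vertices and sets of
    embeddings. *)
Let type_le (W : choiceType) (A : V -> set W) (act : (V -> V) -> W -> W) :
  (forall v, finite_set (A v)) ->
  (forall f g, auto_pair e f g -> injective (act f)) ->
  (forall f g v v' w, auto_pair e f g -> f v = v' -> matches e x D f v v' ->
     matches e x D g v' v -> A v w -> A v' (act f w)) ->
  forall v v', st v = st v' -> #|` fset_set (A v)| = #|` fset_set (A v')|.
Proof.
move=> finA inj actA.
have le v v' : st v = st v' -> (#|` fset_set (A v)| <= #|` fset_set (A v')|)%N.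
  move=> /stP[f [g [fg fv m m']]].
  by apply: (card_fset_set_le (f := act f)) => // [|w];
    [exact: inj fg|exact: actA fg fv m m'].
by move=> v v' vv'; apply/eqP; rewrite eqn_leq !le.
Qed.

Let succs v c := [set u | [/\ h u = (h v).+1, e v u & st u = c]].
Let preds u := [set v | (h v).+1 = h u /\ e u v].

Let card_succs v v' c : st v = st v' ->
  #|` fset_set (succs v c)| = #|` fset_set (succs v' c)|.
Proof.
apply: (type_le (A := fun v => succs v c) (act := fun f => f)) =>
  [{}v|f g|f g {}v {}v' u fg fv m m'].
- by apply: (@finite_level (h v).+1) => u [].
- by case=> /can_inj.
move=> [hu vu <-].
have vu_cone : (h v + d v u = h u)%N.
  have := dist_edge vu; have := dist_triangle e_conn x v u; lia.
split; first by have := m u (near_cone_cone D vu_cone); lia.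
  by rewrite -fv; case: fg => _ _ ->.
apply/stP/same_cone_type_sym; exact: same_cone_type_succ fg fv m m' vu_cone.
Qed.

Let card_preds v v' : st v = st v' -> #|` fset_set (preds v)| = #|` fset_set
  (preds v')|.
Proof.
apply: (type_le (A := preds) (act := fun f => f)) =>
  [{}v|f g|f g {}v {}v' u fg fv m m'].
- by apply: (@finite_level (h v).-1) => u [<-].
- by case=> /can_inj.
move=> [hu vu]; split; last by rewrite -fv; case: fg => _ _ ->.
have vu_near : near_cone e x D v u.
  by apply: near_cone_near; exact: leq_trans (dist_edge vu) D_gt0.
by have := m u vu_near; lia.
Qed.

Let X n c : nat := (\sum_(v <- sphere n | st v == c) 1)%N.

(** Both sides count the edges from the sphere of radius [n] to the vertices of type [c] on the next
    sphere. *)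
Let double_count n c :
  (\sum_(v <- sphere n) #|` fset_set (succs v c)| =
   \sum_(u <- sphere n.+1 | st u == c) #|` fset_set (preds u)|)%N.
Proof.
transitivity (\sum_(v <- sphere n) \sum_(u <- sphere n.+1 | (st u == c) && e v
  u) 1)%N.
  rewrite big_seq [RHS]big_seq; apply: eq_bigr => v;
    rewrite in_sphere => /eqP hv.
  apply: card_fset_set_sum => u; rewrite in_sphere -hv; split.
    by move=> [-> -> ->]; rewrite !eqxx.
  by move=> [/eqP hu /andP[/eqP su vu]].
rewrite (exchange_big_dep (fun u => st u == c))/=; last by move=> v u _ /andP[].
rewrite big_seq_cond [RHS]big_seq_cond.
apply: eq_bigr => u /andP[]; rewrite in_sphere => /eqP hu su; rewrite su.
symmetry; apply: card_fset_set_sum => v; rewrite in_sphere.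
split; first by move=> [vu]; rewrite e_sym => ->; rewrite -eqSS vu hu eqxx.
by move=> [/eqP hv vu]; split; [rewrite hv hu|rewrite e_sym].
Qed.

Let preds_gt0 u : (0 < h u)%N -> (0 < #|` fset_set (preds u)|)%N.
Proof.
move=> hu; have [c cg] := geodesic_exists e_conn x u.
have nl : ((h u).-1 <= h u)%N by exact: leq_pred.
have [hc _] := geodesic_dist e_conn cg nl.
rewrite cardfs_gt0; apply/fset0Pn; exists (c (h u).-1).
have fin : finite_set (preds u) by apply: (@finite_level (h u).-1) => v [<-].
rewrite in_fset_set//; apply: mem_set; split; first by rewrite hc prednK.
have [_ cl ce] := cg; rewrite e_sym -[X in e _ X]cl -[in X in e _ X](prednK hu).
by apply: ce; rewrite prednK.
Qed.

Variable R : realType.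

(** The default [x] serves the labels that no vertex has, for which the counts [X n] vanish. *)
Let rep t : V := if pselect (exists v, st v = t) is left hv then projT1
  (cid hv) else x.

Let st_rep v : st (rep (st v)) = st v.
Proof. by rewrite /rep; case: pselect => [hv|[]];
  [exact: projT2 (cid hv)|exists v]. Qed.

(** A vertex of type [c] is counted once from each of its predecessors, hence the division. The
    quotient is 0 if [rep c] has no predecessor. *)
Let M (s c : T) : R := #|` fset_set (succs (rep s) c)|%:R / #|` fset_set
  (preds (rep c))|%:R.

Let X_succ n c : (X n.+1 c)%:R = \sum_s (X n s)%:R * M s c :> R.
Proof.
have E : (X n.+1 c * #|` fset_set (preds (rep c))| =
    \sum_s X n s * #|` fset_set (succs (rep s) c)|)%N.
  transitivity (\sum_(v <- sphere n) #|` fset_set (succs v c)|)%N.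
    rewrite double_count /X big_distrl/=; apply: eq_bigr => u /eqP <-.
    by rewrite mul1n; apply: card_preds; exact: st_rep.
  rewrite (partition_big st xpredT)//=; apply: eq_bigr => s _.
  rewrite /X big_distrl/=; apply: eq_bigr => v /eqP <-.
  by rewrite mul1n; apply: card_succs; rewrite st_rep.
(* In the first case, a vertex of type [c] on a sphere of positive radius would have a predecessor,
   so both sides are 0. *)
have [p0|p0] := eqVneq #|` fset_set (preds (rep c))| 0%N.
  rewrite [RHS]big1 => [|s _]; last by rewrite /M p0 invr0 !mulr0.
  rewrite /X big_seq_cond big1// => u /andP[];
    rewrite in_sphere => /eqP hu /eqP su.
  have := preds_gt0 (u := u); rewrite hu => /(_ isT).
  by rewrite -(card_preds (v := rep c)) ?p0// -su st_rep.
have p0R : #|` fset_set (preds (rep c))|%:R != 0 :> R by rewrite pnatr_eq0.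
apply: (mulIf p0R); rewrite -natrM E natr_sum mulr_suml; apply: eq_bigr => s _.
by rewrite natrM /M -mulrA divfK.
Qed.

Let tame_X : exists2 p, (0 < p)%N & forall s c,
  tame (fun m => (X (p * m + s) c)%:R : R) /\
  tame (fun m => (\sum_(k < (p * m + s).+1) X k c)%:R : R).
Proof.
(* The second copy of the types accumulates the partial sums, so that both families obey one linear
   recursion with a nonnegative matrix. *)
pose A (i j : T + T) : R := match i, j with
  | inl s, inl c => M s c
  | inl s, inr c => M s c
  | inr s, inr c => (s == c)%:R
  | inr _, inl _ => 0
  end.
pose z n (i : T + T) : R := match i with
  | inl c => (X n c)%:R
  | inr c => (\sum_(k < n.+1) X k c)%:R
  end.
have M0 s c : 0 <= M s c by rewrite divr_ge0.
have [||n [c|c]|p p0 H] := @tame_linear_system R _ A z.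
- by move=> [s|s] [c|c] //=.
- by move=> n [c|c] /=; exact: ler0n.
- rewrite big_sumType/= [X in _ + X]big1 ?addr0; last by move=> s _;
  rewrite mulr0.
  exact: X_succ.
- rewrite big_sumType/= big_ord_recr/= natrD X_succ addrC; congr (_ + _).
  rewrite [RHS](bigD1 c)//= eqxx mulr1 [X in _ + X]big1 ?addr0// => s /negbTE
    ->.
  by rewrite mulr0.
exists p => // s c; split; first exact: (H s (inl c)).
exact: (H s (inr c)).
Qed.

Variables (Y : finType) (eY : rel Y) (y0 : Y).
Hypothesis eY_conn : connected_graph eY.
Hypothesis eY_diam : forall y, (dist eY y0 y <= D)%N.

Let rooted (v : V) (j : nat) : set {ffun Y -> V} :=
  [set f : {ffun Y -> V} | [/\ injective f, {mono f : a b / eY a b >-> e a b},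
    f y0 = v &
               forall y, (h (f y) <= h v + j)%N]].

Let finite_rooted v j : finite_set (rooted v j).
Proof. by apply: (sub_finite_set _ (finite_maps Y
  (finite_ball x e_conn e_fin (h v + j)))) => f []. Qed.

Let mono_dist (f : Y -> V) y : {mono f : a b / eY a b >-> e a b} ->
  (d (f y0) (f y) <= D)%N.
Proof.
move=> fm; apply: leq_trans (eY_diam y).
have [w [p <- <-]] := dist_path eY_conn y0 y.
rewrite -last_map -(size_map f); apply: dist_le_size.
by rewrite path_map; apply: sub_path p => a b /=; rewrite fm.
Qed.

(** The image of [Y] lies within [D] of the root, hence in its near cone, so a matching automorphism
    keeps the heights relative to the root. *)
Let card_rooted v v' j : st v = st v' ->
  #|` fset_set (rooted v j)| = #|` fset_set (rooted v' j)|.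
Proof.
apply: (type_le (A := rooted^~ j) (act := fun f k => [ffun y => f (k y)])) =>
  [//|f g|f g {}v {}v' k fg fv m m'].
  move=> [/can_inj f_inj _ _] k k' /ffunP E; apply/ffunP => y; apply: f_inj.
  by have := E y; rewrite !ffunE.
move=> [k_inj km ky0 kh]; have [fK _ fm] := fg; split.
- by move=> a b; rewrite !ffunE => /(can_inj fK)/k_inj.
- by move=> a b; rewrite !ffunE fm km.
- by rewrite ffunE ky0.
move=> y; rewrite ffunE.
have vk_near : near_cone e x D v (k y).
  by apply: near_cone_near; rewrite -ky0; exact: mono_dist.
by have := m _ vk_near; have := kh y; lia.
Qed.

(** An embedding cannot rise more than [D] above its root, so a bound beyond [D] is no
    restriction. *)
Let rooted_const v j : (D <= j)%N -> rooted v j = rooted v D.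
Proof.
move=> Dj; apply/seteqP; split=> f [f_inj fm fv fh]; split=> // y.
  have := mono_dist y fm; rewrite fv; have := dist_triangle e_conn x v (f y);
    lia.
by have := fh y; lia.
Qed.

Let K c j : nat := #|` fset_set (rooted (rep c) j)|.

(** Embeddings are sorted by the height [m] and the type [c] of the image of [y0], which leaves a
    height of [n - m] above the root. *)
Let count_eq n : num_embeddings eY e (graph_ball e x n) =
  (\sum_(m < n.+1) \sum_c X m c * K c (n - m))%N.
Proof.
rewrite /num_embeddings; set E := embeddings _ _ _.
have EB f : E f <-> [/\ injective f, {mono f : a b / eY a b >-> e a b} & forall
  y, (h (f y) <= n)%N].
  split=> -[f_inj fm fh]; split=> // y.
    exact: (graph_ballE e_conn x n (f y)).1 (fh y).
  exact: (graph_ballE e_conn x n (f y)).2 (fh y).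
have finE : finite_set E by apply: (sub_finite_set _
  (finite_maps Y (finite_ball x e_conn e_fin n))) => f /EB[].
transitivity (\sum_(f <- fset_set E) 1)%N;
  first by rewrite big_const_seq count_predT iter_addn_0 mul1n.
have hE f : f \in fset_set E -> (h (f y0) <= n)%N.
  by rewrite in_fset_set// => /set_mem/EB[_ _]; apply.
rewrite big_seq (partition_big (fun f : {ffun Y -> V} => inord (h (f y0)) :
  'I_n.+1) xpredT)//=.
apply: eq_bigr => m _.
transitivity (\sum_(f <- fset_set E | h (f y0) == m) 1)%N.
  rewrite [RHS]big_seq_cond; apply: eq_bigl => f.
  apply: andb_id2l => /hE hf; apply/eqP/eqP => [<-|hm]; first by rewrite inordK.
  by apply: val_inj; rewrite /= inordK.
transitivity (\sum_(v <- sphere m) #|` fset_set (rooted v (n - m))|)%N;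
  last first.
  rewrite (partition_big st xpredT)//=; apply: eq_bigr => c _.
  rewrite /X big_distrl/=; apply: eq_bigr => v /eqP <-.
  by rewrite mul1n; apply: card_rooted; rewrite st_rep.
transitivity (\sum_(v <- sphere m) \sum_(f <- fset_set E | f y0 == v) 1)%N;
  last first.
  rewrite big_seq [RHS]big_seq; apply: eq_bigr => v;
    rewrite in_sphere => /eqP hv.
  symmetry; apply: card_fset_set_sum => f; rewrite in_fset_set//.
  have mn : (m <= n)%N by rewrite -ltnS.
  rewrite /rooted /= hv subnKC//; split.
    by move=> [f_inj fm fv fh]; split; [apply/mem_set/EB|apply/eqP].
  by move=> [/set_mem/EB[f_inj fm fh] /eqP fv].
under [RHS]eq_bigr do rewrite big_mkcond.
rewrite exchange_big/= big_mkcond/=; apply: eq_bigr => f _.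
rewrite -big_mkcond/= -big_filter.
case: ifP => [/eqP hf|hf]; last first.
  rewrite big1_seq// => v /andP[_]; rewrite mem_filter in_sphere =>
    /andP[/eqP <-].
  by rewrite hf.
have fS : f y0 \in sphere m by rewrite in_sphere hf.
rewrite big_filter big_mkcond (bigD1_seq (f y0)) ?fset_uniq//= eqxx.
by rewrite big1// => v; rewrite eq_sym => /negbTE ->.
Qed.

(** Roots of height at most [n] meet no restriction in the ball of radius [n + D], so they
    contribute multiples of partial sums of [X]; the last [D] spheres contribute multiples of single
    values. *)
Lemma tame_num_embeddings : exists2 p, (0 < p)%N & forall s,
  tame (fun m => (num_embeddings eY e (graph_ball e x (p * m + s + D)))%:R : R).
Proof.
have [p p0 tX] := tame_X; exists p => // s.
have split_count n : num_embeddings eY e (graph_ball e x (n + D)) =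
   (\sum_c (K c D * \sum_(k < n.+1) X k c +
           \sum_(i < D) K c (D - i.+1) * X (n + i.+1) c))%N.
  rewrite count_eq -(big_mkord xpredT (fun m => \sum_c X m c * K c
    (n + D - m))%N).
  rewrite (@big_cat_nat _ _ _ n.+1)//=; last by rewrite ltnS leq_addr.
  rewrite big_split/=; congr (_ + _)%N.
    rewrite exchange_big/=; apply: eq_bigr => c _.
    rewrite big_distrr/= -(big_mkord xpredT (fun k => K c D * X k c)%N).
    rewrite big_nat [RHS]big_nat; apply: eq_bigr => k /andP[_ kn].
    by rewrite mulnC /K rooted_const//; lia.
  rewrite exchange_big; apply: eq_bigr => c _ /=.
  rewrite -{1}[n.+1]add0n big_addn subSS addKn.
  rewrite big_mkord; apply: eq_bigr => i _; rewrite mulnC.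
  by congr (K c _ * X _ c)%N; lia.
have Tm : tame (fun m => \sum_c ((K c D)%:R *
  (\sum_(k < (p * m + s).+1) X k c)%:R +
    \sum_(i < D) (K c (D - i.+1))%:R * (X (p * m + (s + i.+1)) c)%:R) : R).
  apply: tame_sum => c; apply: tameD; first by apply: tameZ => //;
    exact: (tX s c).2.
  by apply: tame_sum => i; apply: tameZ => //; exact: (tX (s + i.+1)%N c).1.
apply: (tame_eq (N := 0%N)) Tm => m _; rewrite split_count natr_sum.
apply: eq_bigr => c _; rewrite natrD natrM; congr (_ + _).
by rewrite natr_sum; apply: eq_bigr => i _; rewrite natrM addnA.
Qed.

End Counting.

(** * Finiteness of the set of opposite series *)

Lemma tame_cst (R : realType) (c : R) : 0 <= c -> tame (fun _ : nat => c).
Proof.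
move=> c0; have := @tameZ _ c (fun=> 1) c0.
rewrite mulr1; apply; right; exists 0%N, 1, 1; split=> //.
apply: (@cvgn_near_eq _ (fun=> 1) _ _ 0%N) => [n _|]; last exact: cvg_cst.
by rewrite /scale beta0 expr1n mulr1 divr1.
Qed.

Theorem theorem5p3 (R : realType) (V : choiceType) (e : rel V) (x : V)
    (Y : finType) (eY : rel Y)
    (e_simple : simple_graph e) (e_hyperbolike : hyperbolike R e)
    (eY_simple : simple_graph eY) (eY_connected : connected_graph eY) :
  finite_set (opposite_series (ball_series R eY e x)).
Proof.
have [e_sym _] := e_simple.
have [delta delta0 [e_conn e_fin e_hyp e_trans]] := e_hyperbolike.
have thin := thin_triangles e_sym e_conn delta0 e_hyp.
have finE n : finite_set (embeddings eY e (graph_ball e x n)).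
  have finB : finite_set (graph_ball e x n).
    apply: (sub_finite_set _ (finite_ball x e_conn e_fin n)) => v.
    by move=> /(graph_ballE e_conn).
  by apply: (sub_finite_set _ (finite_maps Y finB)) => f [].
have mono n : (num_embeddings eY e (graph_ball e x n) <=
    num_embeddings eY e (graph_ball e x n.+1))%N.
  apply: (card_fset_set_le (f := id)) => // f [f_inj fm fB]; split=> // y.
  have [w [xw wy wn]] := fB y; exists w; split=> //; exact: leqW.
(* An empty [Y] has no vertex to serve as a root; its count does not depend on the radius. *)
have [y0|Y0] := pselect (inhabited Y); last first.
  apply: (@finite_opposite_series _ _ 1 0) => // [n|s].
    by rewrite /ball_series ler_nat.
  have E n : ball_series R eY e x n = ball_series R eY e x 0.
    rewrite /ball_series /num_embeddings; congr (#|` fset_set _|%:R).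
    apply/seteqP; split=> f [f_inj fm _]; split=> // y; by case: Y0.
  by under eq_fun do rewrite E; apply: tame_cst; rewrite /ball_series ler0n.
case: y0 => y0.
(* The successor makes [D] positive, as the cone types require. *)
pose D := (\max_y dist eY y0 y).+1.
have [T [st stP]] := finite_cone_types x e_sym e_conn e_fin e_trans
  (ltn0Sn _ : (0 < D)%N) thin.
have diam y : (dist eY y0 y <= D)%N by apply: leqW; exact: leq_bigmax.
have [p p0 H] := tame_num_embeddings e_sym e_conn e_fin (ltn0Sn _ : (0 < D)%N)
  stP R eY_connected diam.
apply: (@finite_opposite_series _ _ p D) => // n.
by rewrite /ball_series ler_nat.
Qed.
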